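(* Suppose the structure condition (S) (see context) holds for $(a,z)$. Let $p$ be a smooth positive probability density and $f=\log\frac p\pi\in C^\infty(\mathbb R^{n+m};\mathbb R)$. Then for every $\beta\in\mathbb R$, $$\int\Big[\widetilde\Gamma_2(f,f)+\widetilde\Gamma_2^{z,\pi}(f,f)+\Gamma_{\mathcal I_{a,z}}(f,f)\Big]p\,dx=\int\Big[\|\mathfrak{Hess}_\beta f\|_{\mathrm F}^2+\mathfrak R(\nabla f,\nabla f)\Big]p\,dx,$$ where $$\|\mathfrak{Hess}_\beta f\|_{\mathrm F}^2=[\mathsf Q\mathsf X+\Lambda_1]^{\mathsf T}[\mathsf Q\mathsf X+\Lambda_1]+[\mathsf P\mathsf X+\Lambda_2]^{\mathsf T}[\mathsf P\mathsf X+\Lambda_2],$$ with $\mathsf X_{\hat i\hat k}=\partial^2f/\partial x_{\hat i}\partial x_{\hat k}$ the vectorized Hessian of $f$, $\mathsf Q=a^{\mathsf T}\otimes a^{\mathsf T}$, $\mathsf P=a^{\mathsf T}\otimes z^{\mathsf T}$, i.e. $(\mathsf Q\mathsf X)_{ik}=\sum_{\hat i,\hat k=1}^{n+m}a_{\hat ii}a_{\hat kk}\mathsf X_{\hat i\hat k}$ for $i,k\le n$ and $(\mathsf P\mathsf X)_{ik}=\sum_{\hat i,\hat k=1}^{n+m}a_{\hat ii}z_{\hat kk}\mathsf X_{\hat i\hat k}$ for $i\le n,k\le m$, and where $\Lambda_1,\Lambda_2$ and $\mathfrak R(\mathsf U,\mathsf U)$ (all depending on $\beta$) are the quantities defined in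 the context with $\mathsf U=\nabla f$.
   Context: Setting. Let $n\ge1$, $m\ge0$ be integers, $b:\mathbb R^{n+m}\to\mathbb R^{n+m}$, $a:\mathbb R^{n+m}\to\mathbb R^{(n+m)\times n}$ smooth and Lipschitz, $a(x)$ of rank $n$. Let $a_i$ be the $i$-th column of $a$ (components $a_i^r=a_{ri}$), $\mathbf A_i=\sum_ra_i^r\partial_{x_r}$. The SDE $dX_t=b(X_t)dt+\sqrt2a(X_t)dB_t$ satisfies the weak H\''ormander condition (the Lie algebra generated by $\mathbf A_1,\dots,\mathbf A_n$ and their iterated brackets with each other and with $\mathbf A_0=\sum_rb_r\partial_{x_r}$ spans $\mathbb R^{n+m}$ at every point) and has a unique invariant density $\pi\in C^2$, positive everywhere: $-\nabla\cdot(\pi b)+\sum_{i,j}\partial^2_{x_ix_j}((aa^{\mathsf T})_{ij}\pi)=0$. Put $\gamma=aa^{\mathsf T}\nabla\log\pi-b+\big(\sum_j\partial_{x_j}(aa^{\mathsf T})_{ij}\big)_i$, so $\nabla\cdot(\pi\gamma)=0$. All integrals are over $\mathbb R^{n+m}$; integrations by parts carry no boundary terms. Structure condition (S): $z:\mathbb R^{n+m}\to\mathbb R^{(n+m)\times m}$ is smooth, $\mathrm{Rank}(aa^{\mathsf T}+zz^{\mathsf T})=n+m$ at every $x$, and, with $z_k$ the $k$-th column of $z$ (components $z_k^r$) and $\mathbf Z_k=\sum_rz_k^r\partial_{x_r}$, for all $i\le n$, $k\le m$ the vector field $\sum_r(\mathbf Z_ka_i^r)\partial_{x_r}$ lies in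 $\mathrm{Span}\{\mathbf A_1,\dots,\mathbf A_n\}$. Define coefficient functions by $\partial_{x_r}a_k=\sum_{l=1}^n\lambda^{rk}_la_l+\sum_{l=1}^m\lambda^{rk}_{l+n}z_l$, $\partial_{x_r}z_k=\sum_{l=1}^n\omega^{rk}_la_l+\sum_{l=1}^m\omega^{rk}_{l+n}z_l$, $\gamma=\sum_{l=1}^n\alpha_la_l+\sum_{l=1}^m\alpha_{l+n}z_l$; the condition then reads $\sum_r(\mathbf Z_ka_i^r)\partial_{x_r}=\sum_{k'=1}^{n+m}\sum_{l=1}^nz_k^{k'}\lambda^{k'i}_l\mathbf A_l$. Gamma operators. $\widetilde Lf=\nabla\cdot(aa^{\mathsf T}\nabla f)+\langle aa^{\mathsf T}\nabla\log\pi,\nabla f\rangle$, $\widetilde L_zf=\nabla\cdot(zz^{\mathsf T}\nabla f)+\langle zz^{\mathsf T}\nabla\log\pi,\nabla f\rangle$; $\Gamma_1(f,g)=\langle a^{\mathsf T}\nabla f,a^{\mathsf T}\nabla g\rangle$, $\Gamma_1^z(f,g)=\langle z^{\mathsf T}\nabla f,z^{\mathsf T}\nabla g\rangle$. Then $\widetilde\Gamma_2(f,f)=\frac12\widetilde L\Gamma_1(f,f)-\Gamma_1(\widetilde Lf,f)$; $\widetilde\Gamma_2^{z,\pi}(f,f)=\frac12\widetilde L\Gamma_1^z(f,f)-\Gamma_1^z(\widetilde Lf,f)+\mathrm{div}^\pi_z(\Gamma_{1,\nabla(aa^{\mathsf T})}(f,f))-\mathrm{div}^\pi_a(\Gamma_{1,\nabla(zz^{\mathsf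 T})}(f,f))$, where $\mathrm{div}^\pi_a(F)=\frac1\pi\nabla\cdot(\pi aa^{\mathsf T}F)$, $\mathrm{div}^\pi_z(F)=\frac1\pi\nabla\cdot(\pi zz^{\mathsf T}F)$, and $\Gamma_{1,\nabla(aa^{\mathsf T})}(f,f)$, $\Gamma_{1,\nabla(zz^{\mathsf T})}(f,f)$ are the vector fields with $r$-th components $\langle\nabla f,\partial_{x_r}(aa^{\mathsf T})\nabla f\rangle$, $\langle\nabla f,\partial_{x_r}(zz^{\mathsf T})\nabla f\rangle$; $\Gamma_{\mathcal I_{a,z}}(f,f)=(\widetilde Lf+\widetilde L_zf)\langle\nabla f,\gamma\rangle-\frac12\langle\nabla(\Gamma_1(f,f)+\Gamma_1^z(f,f)),\gamma\rangle$. Definition of $\mathfrak R$. Derivatives of vector-valued functions are componentwise, $\cdot$ is the Euclidean inner product, derivatives below act only on coefficients $a,z,\pi,\gamma$ and never on $\mathsf U$. Let $h=aa^{\mathsf T}\nabla\log\pi$, $(\nabla\gamma)_{ij}=\partial_{x_i}\gamma_j$, $\mathrm{div}\,v=\sum_r\partial_{x_r}v^r$. Set $$\mathfrak R_a(\mathsf U,\mathsf U)=\sum_{i,k=1}^n[\mathbf A_i(\mathbf A_ia_k)-\mathbf A_k(\mathbf A_ia_i)]\cdot\mathsf U\,(a_k\cdot\mathsf U)+\sum_{i=1}^n[(h\cdot\nabla)a_i-\mathbf A_ih]\cdot\mathsf U\,(a_i\cdot\mathsf U)+\sum_{i,k=1}^n(\mathrm{div}\,a_i)[\mathbf A_ia_k-\mathbf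 A_ka_i]\cdot\mathsf U\,(a_k\cdot\mathsf U)-\sum_{i,k=1}^n\mathbf A_k(\mathrm{div}\,a_i)(a_i\cdot\mathsf U)(a_k\cdot\mathsf U),$$ $$\mathfrak R_z(\mathsf U,\mathsf U)=\sum_{i=1}^n\sum_{k=1}^m[\mathbf A_i(\mathbf A_iz_k)-\mathbf Z_k(\mathbf A_ia_i)]\cdot\mathsf U\,(z_k\cdot\mathsf U)+\sum_{k=1}^m[(h\cdot\nabla)z_k-\mathbf Z_kh]\cdot\mathsf U\,(z_k\cdot\mathsf U)+\sum_{i=1}^n\sum_{k=1}^m(\mathrm{div}\,a_i)[\mathbf A_iz_k-\mathbf Z_ka_i]\cdot\mathsf U\,(z_k\cdot\mathsf U)-\sum_{i=1}^n\sum_{k=1}^m\mathbf Z_k(\mathrm{div}\,a_i)(a_i\cdot\mathsf U)(z_k\cdot\mathsf U),$$ $$\mathfrak R_\pi(\mathsf U,\mathsf U)=2\sum_{k=1}^m\sum_{i=1}^n\Big\{\big[(\mathrm{div}\,z_k)\mathbf Z_ka_i+\mathbf Z_k(\mathbf Z_ka_i)+(z_k\cdot\nabla\log\pi)\mathbf Z_ka_i\big]\cdot\mathsf U\,(a_i\cdot\mathsf U)+(\mathbf Z_ka_i\cdot\mathsf U)^2\Big\}$$ $$-2\sum_{k=1}^m\sum_{i=1}^n\Big\{\big[(\mathrm{div}\,a_i)\mathbf A_iz_k+\mathbf A_i(\mathbf A_iz_k)+(a_i\cdot\nabla\log\pi)\mathbf A_iz_k\big]\cdot\mathsf U\,(z_k\cdot\mathsf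 U)+(\mathbf A_iz_k\cdot\mathsf U)^2\Big\},$$ $$\mathfrak R_{\mathcal I_a}(\mathsf U,\mathsf U)=(\mathsf U\cdot\gamma)\Big[\sum_{i=1}^n(\mathrm{div}\,a_i)(a_i\cdot\mathsf U)+\sum_{i=1}^n(\mathbf A_ia_i)\cdot\mathsf U+h\cdot\mathsf U\Big]-\sum_{i=1}^n\big((\gamma\cdot\nabla)a_i\cdot\mathsf U\big)(a_i\cdot\mathsf U),$$ $$\mathfrak R_{\gamma_a}(\mathsf U,\mathsf U)=\tfrac12\sum_r\gamma_r\langle\mathsf U,\partial_{x_r}(aa^{\mathsf T})\mathsf U\rangle-\langle\nabla\gamma\,\mathsf U,aa^{\mathsf T}\mathsf U\rangle,\quad \mathfrak R_{\gamma_z}(\mathsf U,\mathsf U)=\tfrac12\sum_r\gamma_r\langle\mathsf U,\partial_{x_r}(zz^{\mathsf T})\mathsf U\rangle-\langle\nabla\gamma\,\mathsf U,zz^{\mathsf T}\mathsf U\rangle,$$ $\mathsf D_{ik}=(\mathbf A_ia_k)\cdot\mathsf U$ ($i,k\le n$), $\mathsf E_{ik}=(\mathbf A_iz_k)\cdot\mathsf U$ ($i\le n,k\le m$), and, with $r$ summed over $1,\dots,n+m$, for $i,l\le n$, $$(\Lambda_1)_{il}=\sum_{k=1}^n\sum_r[a_i^r\lambda^{rk}_l-a_k^r\lambda^{ri}_l]a_k\cdot\mathsf U+\sum_{k=1}^m\sum_r[a_i^r\omega^{rk}_l-z_k^r\lambda^{ri}_l]z_k\cdot\mathsf U-\sum_{k=1}^m\sum_ra_i^r\omega^{rk}_l\,z_k\cdot\mathsf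 U-\tfrac\beta2\alpha_l\,a_i\cdot\mathsf U+\tfrac\beta2(\mathsf U\cdot\gamma)\mathbf 1_{\{i=l\}}+\mathsf D_{il},$$ and for $i\le n$, $l\le m$, $$(\Lambda_2)_{il}=\sum_{k=1}^n\sum_r[a_i^r\lambda^{rk}_{l+n}-a_k^r\lambda^{ri}_{l+n}]a_k\cdot\mathsf U+\sum_{k=1}^m\sum_r[a_i^r\omega^{rk}_{l+n}-z_k^r\lambda^{ri}_{l+n}]z_k\cdot\mathsf U+\sum_{k=1}^n\sum_rz_l^r\lambda^{rk}_i\,a_k\cdot\mathsf U+(\mathbf Z_la_i)\cdot\mathsf U-\sum_{k=1}^m\sum_ra_i^r\omega^{rk}_{l+n}\,z_k\cdot\mathsf U-(\mathbf A_iz_l)\cdot\mathsf U-\tfrac\beta2\alpha_{l+n}\,a_i\cdot\mathsf U+\mathsf E_{il}.$$ Finally $$\mathfrak R(\mathsf U,\mathsf U)=(\mathfrak R_a+\mathfrak R_z+\mathfrak R_\pi)(\mathsf U,\mathsf U)-|\Lambda_1|^2-|\Lambda_2|^2+|\mathsf D|^2+|\mathsf E|^2+(\beta\mathfrak R_{\mathcal I_a}+(1-\beta)\mathfrak R_{\gamma_a}+\mathfrak R_{\gamma_z})(\mathsf U,\mathsf U).$$ *)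

(* Defs.v *)
(* R^d is the type ['cV[R]_d] of column vectors; the columns of the matrices
   [a x] and [z x] are the vectors a_i(x) and z_k(x). *)
From HB Require Import structures.
From mathcomp Require Import all_boot all_order all_algebra.
From mathcomp Require Import all_classical all_reals all_analysis.

Set Implicit Arguments.
Unset Strict Implicit.
Unset Printing Implicit Defensive.

Import Order.TTheory GRing.Theory Num.Theory.
Import numFieldNormedType.Exports.

Local Open Scope classical_set_scope.
Local Open Scope ring_scope.

(* The library has no Lebesgue measure on R^d: it is built on the Borel (product)
   sigma-algebra of [d.-tuple R] by iterating the binary product measure. *)
Section LebesgueTuple.
Context (R : realType).
Local Notation RT := (measurableTypeR R).

Definition tcons d (xt : RT * d.-tuple RT) : d.+1.-tuple RT :=
  [the d.+1.-tuple RT of xt.1 :: xt.2].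

Lemma measurable_tcons d : measurable_fun [set: RT * d.-tuple RT] (@tcons d).
Proof.
exact: (measurable_cons measurable_fst measurable_snd).
Qed.

Section step.
Context (d : nat) (nu : {sigma_finite_measure set (d.-tuple RT) -> \bar R}).

Definition lebesgue_step : set (d.+1.-tuple RT) -> \bar R :=
  pushforward (@lebesgue_measure R \x nu)%E (@tcons d).

Let lebesgue_step0 : lebesgue_step set0 = 0%E.
Proof. by rewrite /lebesgue_step /pushforward preimage_set0 measure0. Qed.

Let lebesgue_step_ge0 A : (0 <= lebesgue_step A)%E.
Proof. by rewrite /lebesgue_step /pushforward; exact: measure_ge0. Qed.

Let lebesgue_step_sigma_additive : semi_sigma_additive lebesgue_step.
Proof.
move=> F mF tF mUF; rewrite /lebesgue_step /pushforward preimage_bigcup.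
have mc B : measurable B -> measurable (@tcons d @^-1` B).
  by move=> mB; rewrite -[X in measurable X]setTI; exact: measurable_tcons.
apply: measure_semi_sigma_additive.
- by move=> n; exact: mc.
- apply/trivIsetP => /= i j _ _ ij; rewrite -preimage_setI.
  by move/trivIsetP : tF => /(_ _ _ _ _ ij) ->//; rewrite preimage_set0.
- by rewrite -preimage_bigcup; exact: mc.
Qed.

HB.instance Definition _ := isMeasure.Build _ _ _ lebesgue_step
  lebesgue_step0 lebesgue_step_ge0 lebesgue_step_sigma_additive.

Let lebesgue_step_sigma_finite : sigma_finite setT lebesgue_step.
Proof.
have [F UF mF] : sigma_finite setT (@lebesgue_measure R \x nu)%E.
  have /sigma_finiteP[F [TF ndF Foo]] := sigma_finiteT (@lebesgue_measure R).
  have /sigma_finiteP[G [TG ndG Goo]] := sigma_finiteT nu.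
  exists (fun n => F n `*` G n).
    rewrite -setXTT TF TG predeqE => -[x y]; split.
      move=> [/= [n _ Fnx] [k _ Gky]]; exists (maxn n k) => //; split.
      - by move: x Fnx; exact/subsetPset/ndF/leq_maxl.
      - by move: y Gky; exact/subsetPset/ndG/leq_maxr.
    by move=> [n _ []/= ? ?]; split; exists n.
  move=> k; have [? ?] := Foo k; have [? ?] := Goo k.
  split; first exact: measurableX.
  by rewrite product_measure1E// lte_mul_pinfty// ge0_fin_numE.
pose unc (t : d.+1.-tuple RT) : RT * d.-tuple RT :=
  (tnth t ord0, [tuple of behead t]).
have munc : measurable_fun setT unc.
  apply/measurable_fun_pairP; split.
    exact: measurable_tnth.
  exact: measurable_behead.
have uncK xt : unc (tcons xt) = xt.
  by case: xt => x t; congr pair; apply/val_inj.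
exists (fun i => unc @^-1` F i).
  by rewrite -preimage_bigcup -UF preimage_setT.
move=> i; have [mFi Fi] := mF i; split.
  by rewrite -[X in measurable X]setTI; exact: munc.
rewrite /lebesgue_step /pushforward (_ : _ @^-1` _ = F i)//.
by apply/seteqP; split => xt /=; rewrite uncK.
Qed.

HB.instance Definition _ := Measure_isSigmaFinite.Build _ _ _ lebesgue_step
  lebesgue_step_sigma_finite.

End step.

Fixpoint lebesgue_tuple (d : nat) :
    {sigma_finite_measure set (d.-tuple RT) -> \bar R} :=
  match d with
  | 0 => @dirac _ (0.-tuple RT) [tuple] R
  | d'.+1 => lebesgue_step (lebesgue_tuple d')
  end.

Definition col_of_tuple d (t : d.-tuple RT) : 'cV[R]_d := \col_i tnth t i.

End LebesgueTuple.

Section VectorCalculus.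
Context (R : realType) (d : nat).
Local Notation V := ('cV[R]_d).

Definition integral_Rd (g : V -> R) : \bar R :=
  (\int[@lebesgue_tuple R d]_t (g (col_of_tuple t))%:E)%E.

Definition integrable_Rd (g : V -> R) : Prop :=
  (@lebesgue_tuple R d).-integrable setT (fun t => (g (col_of_tuple t))%:E).

Definition partial (r : 'I_d) (g : V -> R) : V -> R :=
  fun x => 'D_(delta_mx r ord0) g x.

Definition partial_mx (p q : nat) (r : 'I_d) (M : V -> 'M[R]_(p, q)) :
    V -> 'M[R]_(p, q) :=
  fun x => \matrix_(i, j) partial r (fun y => M y i j) x.

Fixpoint Ck (k : nat) (g : V -> R) : Prop :=
  match k with
  | 0 => continuous g
  | k'.+1 => [/\ continuous g,
                 forall r x, derivable g x (delta_mx r ord0)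
               & forall r, Ck k' (partial r g)]
  end.

Definition smooth (g : V -> R) : Prop := forall k, Ck k g.

Definition smooth_mx (p q : nat) (M : V -> 'M[R]_(p, q)) : Prop :=
  forall i j, smooth (fun x => M x i j).

Definition dot (u v : V) : R := \sum_r u r ord0 * v r ord0.

Definition grad (g : V -> R) : V -> V := fun x => \col_r partial r g x.

Definition divg (F : V -> V) : V -> R :=
  fun x => \sum_r partial r (fun y => F y r ord0) x.

(* (W . nabla) g, for scalar g and for vector fields F (componentwise). *)
Definition dir (W : V -> V) (g : V -> R) : V -> R :=
  fun x => \sum_r W x r ord0 * partial r g x.

Definition vdir (W F : V -> V) : V -> V :=
  fun x => \sum_r W x r ord0 *: partial_mx r F x.

Definition lie_bracket (W1 W2 : V -> V) : V -> V :=
  fun x => vdir W1 W2 x - vdir W2 W1 x.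

Definition cfield (k : nat) (c : V -> 'M[R]_(d, k)) (i : 'I_k) : V -> V :=
  fun x => col i (c x).

Definition gram (k : nat) (c : V -> 'M[R]_(d, k)) : V -> 'M[R]_d :=
  fun x => c x *m (c x)^T.

Definition gradlog (pi : V -> R) : V -> V := grad (fun x => ln (pi x)).

Definition prob_density (rho : V -> R) : Prop :=
  (forall x, 0 <= rho x) /\ integral_Rd rho = 1%E.

(* In the following operators [c] is instantiated with a or z. *)
Definition gen (k : nat) (c : V -> 'M[R]_(d, k)) (pi f : V -> R) : V -> R :=
  fun x => divg (fun y => gram c y *m grad f y) x
           + dot (gram c x *m gradlog pi x) (grad f x).

Definition Gamma1 (k : nat) (c : V -> 'M[R]_(d, k)) (f g : V -> R) : V -> R :=
  fun x => \sum_i ((c x)^T *m grad f x) i ord0 * ((c x)^T *m grad g x) i ord0.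

Definition Gamma1_nabla (k : nat) (c : V -> 'M[R]_(d, k)) (f : V -> R) :
    V -> V :=
  fun x => \col_r dot (grad f x) (partial_mx r (gram c) x *m grad f x).

Definition div_pi (k : nat) (c : V -> 'M[R]_(d, k)) (pi : V -> R)
    (F : V -> V) : V -> R :=
  fun x => (pi x)^-1 * divg (fun y => pi y *: (gram c y *m F y)) x.

End VectorCalculus.

Section Diffusion.
Context (R : realType) (n m : nat).
Local Notation V := ('cV[R]_(n + m)).
Implicit Types (a : V -> 'M[R]_(n + m, n))
  (z : V -> 'M[R]_(n + m, m)).

Inductive hormander_algebra (b : V -> V) (a : V -> 'M[R]_(n + m, n)) :
    (V -> V) -> Prop :=
| hormander_diffusion i : hormander_algebra b a (cfield a i)
| hormander_drift W :
    hormander_algebra b a W -> hormander_algebra b a (lie_bracket b W)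
| hormander_bracket W1 W2 :
    hormander_algebra b a W1 -> hormander_algebra b a W2 ->
    hormander_algebra b a (lie_bracket W1 W2)
| hormander_linear (s : R) W1 W2 :
    hormander_algebra b a W1 -> hormander_algebra b a W2 ->
    hormander_algebra b a (fun x => s *: W1 x + W2 x).

(* The algebra is closed under linear combinations, so that its values at x
   span R^(n+m) iff every vector is such a value. *)
Definition weak_hormander (b : V -> V) a : Prop :=
  forall x v, exists2 W, hormander_algebra b a W & W x = v.

(* C^2 probability solutions of the stationary Fokker-Planck equation. *)
Definition invariant_density (b : V -> V) a (rho : V -> R) : Prop :=
  [/\ Ck 2 rho, prob_density rho
    & forall x, - divg (fun y => rho y *: b y) x
        + \sum_i \sum_j
            partial i (partial j (fun y => gram a y i j * rho y)) x = 0].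

Definition gamma_field (b : V -> V) a (pi : V -> R) : V -> V :=
  fun x => gram a x *m gradlog pi x - b x
    + \col_i \sum_j partial j (fun y => gram a y i j) x.

Definition structure_condition a z : Prop :=
  [/\ smooth_mx z,
      forall x, \rank (gram a x + gram z x) = (n + m)%N
    & forall i k x, exists c : 'I_n -> R,
        vdir (cfield z k) (cfield a i) x = \sum_l c l *: cfield a l x].

(* Coefficients in the frame (a_1, .., a_n, z_1, .., z_m): the index l is in
   'I_(n + m), [lshift m l] being l and [rshift n l] being l + n. *)
Definition frame_comb a z (c : 'I_(n + m) -> V -> R) : V -> V :=
  fun x => \sum_(l < n) c (lshift m l) x *: cfield a l x
         + \sum_(l < m) c (rshift n l) x *: cfield z l x.

Section Forms.
Variables (a : V -> 'M[R]_(n + m, n)) (z : V -> 'M[R]_(n + m, m)).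
Variables (pi : V -> R) (gam : V -> V).
Local Notation A := (cfield a).
Local Notation Z := (cfield z).
Local Notation h := (fun x => gram a x *m gradlog pi x).

Definition Gamma2 (f : V -> R) : V -> R := fun x =>
  2^-1 * gen a pi (Gamma1 a f f) x - Gamma1 a (gen a pi f) f x.

Definition Gamma2_z_pi (f : V -> R) : V -> R := fun x =>
  2^-1 * gen a pi (Gamma1 z f f) x - Gamma1 z (gen a pi f) f x
  + div_pi z pi (Gamma1_nabla a f) x - div_pi a pi (Gamma1_nabla z f) x.

Definition Gamma_I (f : V -> R) : V -> R := fun x =>
  (gen a pi f x + gen z pi f x) * dot (grad f x) (gam x)
  - 2^-1 * dot (grad (fun y => Gamma1 a f f y + Gamma1 z f f y) x) (gam x).

Definition R_a (x U : V) : R :=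
  \sum_i \sum_k
    dot (vdir (A i) (vdir (A i) (A k)) x - vdir (A k) (vdir (A i) (A i)) x) U
    * dot (A k x) U
  + \sum_i dot (vdir h (A i) x - vdir (A i) h x) U * dot (A i x) U
  + \sum_i \sum_k
      divg (A i) x * dot (vdir (A i) (A k) x - vdir (A k) (A i) x) U
      * dot (A k x) U
  - \sum_i \sum_k dir (A k) (divg (A i)) x * dot (A i x) U * dot (A k x) U.

Definition R_z (x U : V) : R :=
  \sum_i \sum_k
    dot (vdir (A i) (vdir (A i) (Z k)) x - vdir (Z k) (vdir (A i) (A i)) x) U
    * dot (Z k x) U
  + \sum_k dot (vdir h (Z k) x - vdir (Z k) h x) U * dot (Z k x) U
  + \sum_i \sum_k
      divg (A i) x * dot (vdir (A i) (Z k) x - vdir (Z k) (A i) x) U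
      * dot (Z k x) U
  - \sum_i \sum_k dir (Z k) (divg (A i)) x * dot (A i x) U * dot (Z k x) U.

Definition R_pi (x U : V) : R :=
  2 * \sum_k \sum_i
    (dot (divg (Z k) x *: vdir (Z k) (A i) x
          + vdir (Z k) (vdir (Z k) (A i)) x
          + dot (Z k x) (gradlog pi x) *: vdir (Z k) (A i) x) U
       * dot (A i x) U
     + dot (vdir (Z k) (A i) x) U ^+ 2)
  - 2 * \sum_k \sum_i
    (dot (divg (A i) x *: vdir (A i) (Z k) x
          + vdir (A i) (vdir (A i) (Z k)) x
          + dot (A i x) (gradlog pi x) *: vdir (A i) (Z k) x) U
       * dot (Z k x) U
     + dot (vdir (A i) (Z k) x) U ^+ 2).

Definition R_I_a (x U : V) : R :=
  dot U (gam x)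
    * (\sum_i divg (A i) x * dot (A i x) U
       + \sum_i dot (vdir (A i) (A i) x) U + dot (gram a x *m gradlog pi x) U)
  - \sum_i dot (vdir gam (A i) x) U * dot (A i x) U.

Definition nabla_mx (v : V -> V) : V -> 'M[R]_(n + m) :=
  fun x => \matrix_(i, j) partial i (fun y => v y j ord0) x.

(* R_gamma_a and R_gamma_z are the instances c = a and c = z. *)
Definition R_gamma (k : nat) (c : V -> 'M[R]_(n + m, k)) (x U : V) : R :=
  2^-1 * \sum_r gam x r ord0 * dot U (partial_mx r (gram c) x *m U)
  - dot (nabla_mx gam x *m U) (gram c x *m U).

Definition D_mx (x U : V) : 'M[R]_n :=
  \matrix_(i, k) dot (vdir (A i) (A k) x) U.

Definition E_mx (x U : V) : 'M[R]_(n, m) :=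
  \matrix_(i, k) dot (vdir (A i) (Z k) x) U.

Variables (lam : 'I_(n + m) -> 'I_n -> 'I_(n + m) -> V -> R).
Variables (om : 'I_(n + m) -> 'I_m -> 'I_(n + m) -> V -> R).
Variables (al : 'I_(n + m) -> V -> R) (beta : R).

Definition frame_coefficients : Prop :=
  [/\ forall r k x, partial_mx r (A k) x = frame_comb a z (lam r k) x,
      forall r k x, partial_mx r (Z k) x = frame_comb a z (om r k) x
    & forall x, gam x = frame_comb a z al x].

Definition Lambda1 (x U : V) : 'M[R]_n :=
  \matrix_(i, l)
   (\sum_k (\sum_r (a x r i * lam r k (lshift m l) x
                    - a x r k * lam r i (lshift m l) x)) * dot (A k x) U
    + \sum_k (\sum_r (a x r i * om r k (lshift m l) x
                      - z x r k * lam r i (lshift m l) x)) * dot (Z k x) U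
    - \sum_k (\sum_r a x r i * om r k (lshift m l) x) * dot (Z k x) U
    - beta / 2 * al (lshift m l) x * dot (A i x) U
    + beta / 2 * dot U (gam x) * (i == l)%:R
    + D_mx x U i l).

Definition Lambda2 (x U : V) : 'M[R]_(n, m) :=
  \matrix_(i, l)
   (\sum_k (\sum_r (a x r i * lam r k (rshift n l) x
                    - a x r k * lam r i (rshift n l) x)) * dot (A k x) U
    + \sum_k (\sum_r (a x r i * om r k (rshift n l) x
                      - z x r k * lam r i (rshift n l) x)) * dot (Z k x) U
    + \sum_k (\sum_r z x r l * lam r k (lshift m i) x) * dot (A k x) U
    + dot (vdir (Z l) (A i) x) U
    - \sum_k (\sum_r a x r i * om r k (rshift n l) x) * dot (Z k x) U
    - dot (vdir (A i) (Z l) x) U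
    - beta / 2 * al (rshift n l) x * dot (A i x) U
    + E_mx x U i l).

(* |M|^2 = M^T M for the vectorized matrix M. *)
Definition sqnorm (p q : nat) (M : 'M[R]_(p, q)) : R :=
  \sum_i \sum_j M i j ^+ 2.

Definition frakR (x U : V) : R :=
  (R_a x U + R_z x U + R_pi x U)
  - sqnorm (Lambda1 x U) - sqnorm (Lambda2 x U)
  + sqnorm (D_mx x U) + sqnorm (E_mx x U)
  + (beta * R_I_a x U + (1 - beta) * R_gamma a x U + R_gamma z x U).

Definition QX (f : V -> R) (x : V) : 'M[R]_n :=
  \matrix_(i, k) \sum_(i' < n + m) \sum_(k' < n + m)
    a x i' i * a x k' k * partial i' (partial k' f) x.

Definition PX (f : V -> R) (x : V) : 'M[R]_(n, m) :=
  \matrix_(i, k) \sum_(i' < n + m) \sum_(k' < n + m)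
    a x i' i * z x k' k * partial i' (partial k' f) x.

Definition Hess_beta_sqnorm (f : V -> R) (x : V) : R :=
  sqnorm (QX f x + Lambda1 x (grad f x))
  + sqnorm (PX f x + Lambda2 x (grad f x)).

(* The boundary term of the integration by parts
   \int g (div v) = - \int <grad g, v> is \int div (g v), here F = g v. *)
Definition no_boundary_term (F : V -> V) : Prop :=
  integrable_Rd (divg F) /\ integral_Rd (divg F) = 0%E.

(* The integrations by parts relating p Gamma_I to the forms R_gamma: for c = a
   and c = z, the factor g = (p / pi) <grad f, gam> against the field
   v = pi (c c^T) grad f, and g = p / pi against v = Gamma1^c(f, f) (pi gam). *)
Definition no_boundary_terms (p f : V -> R) : Prop :=
  [/\ no_boundary_term
        (fun x => (p x * dot (grad f x) (gam x)) *: (gram a x *m grad f x)),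
      no_boundary_term
        (fun x => (p x * dot (grad f x) (gam x)) *: (gram z x *m grad f x)),
      no_boundary_term (fun x => (p x * Gamma1 a f f x) *: gam x)
    & no_boundary_term (fun x => (p x * Gamma1 z f f x) *: gam x)].

End Forms.
End Diffusion.

(* Main.v *)
Require Import Defs.
From mathcomp Require Import all_boot all_order all_algebra.
From mathcomp Require Import all_classical all_reals all_analysis.
From mathcomp Require Import measurable_realfun ring lra.
Import Order.TTheory GRing.Theory Num.Theory.
Import numFieldNormedType.Exports.
Local Open Scope classical_set_scope.
Local Open Scope ring_scope.

Set Implicit Arguments.
Unset Strict Implicit.
Unset Printing Implicit Defensive.

(** Write U = grad f, and let A_i and Z_k act as derivations. The two integrands
    differ by a divergence whose integral vanishes, for the following reasons.

    Second-order terms. The generator L of a is a sum of squares of the A_i plus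
    a first-order operator ([genE]), so for a frame c with columns C_k the
    expression L Gamma1 / 2 - Gamma1 (L f, f) equals the sum of the (A_i C_k f)^2
    plus the sum of the (C_k f) [L, C_k] f. From
    [A^2, C] = A [A, C] + [A, C] A ([dir_square_comm]) the second-order part of
    the commutator is twice the Hessian of f at (A_i, [A_i, C_k]), and its
    first-order part, paired with C_k f, sums to R_a for c = a and to R_z for c = z
    ([bochner]). The two weighted divergences in the Gamma2 operator of z contribute
    R_pi and terms linear in the Hessian ([div_pi_Gamma1_nabla]).

    Completing the square. All terms linear in the Hessian are values at a pair
    (A_i, v), except the values at (Z_k, Z_k a_i); the structure condition makes
    Z_k a_i a combination of the A_l, so that symmetry of the Hessian ([schwarz])
    reduces these to the same type ([cross_span]). Expanding v in the frame
    (a, z) turns them into the pairings of QX with Lambda1 - D and of PX with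
    Lambda2 - E ([cross_total]), that is, into the cross terms of the square of
    the beta-Hessian. What remains is R without the forms R_I_a and R_gamma
    ([Gamma2_completed_square]).

    The drift. The contribution of a frame c to Gamma_I can be used pointwise,
    which keeps a Hessian term and gives R_I_a ([gen_dot_drift]), or integrated by
    parts against p, which leaves only R_gamma ([drift_by_parts]); the latter uses
    that pi gam is divergence free ([gamma_field_stationary]). The parameter beta
    is the weight of the first treatment for c = a; for c = z only the second one
    is used. It produces the four divergences with vanishing integral, and adding
    such a function does not change an integral, finite or not
    ([integral_null_perturbation]). *)

(** * Calculus of C^k functions along coordinate directions *)

Section Smooth.
Context (R : realType) (d : nat).
Local Notation V := ('cV[R]_d).
Implicit Types (g k : V -> R).

Lemma dist_half (P Q C e : R) :
  `|P - C| < e / 2 -> `|Q - C| < e / 2 -> `|P - Q| < e.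
Proof.
move=> k1 k2; rewrite [ltRHS]splitr (le_lt_trans (ler_distD C _ _))// ltrD//.
by rewrite distrC.
Qed.

Lemma is_derive_line g (x v : V) (t : R) : derivable g (x + t *: v) v ->
  is_derive t 1 (fun s => g (x + s *: v)) ('D_v g (x + t *: v)).
Proof.
move=> dg.
have E : (fun h : R => h^-1 *: (g (x + (h *: 1 + t) *: v) - g (x + t *: v))) =
         (fun h : R => h^-1 *: (g (h *: v + (x + t *: v)) - g (x + t *: v))).
  by apply/funext => h; rewrite [h *: 1]mulr1 scalerDl addrCA.
split; first by move: dg; rewrite /derivable /shift /= => dg; rewrite E.
by rewrite /derive /shift /= E.
Qed.

(** Second-order calculus is reduced to one real variable: a directional
    derivative is the ordinary derivative of a restriction to a line. *)
Lemma mean_value_line g (x v : V) (t : R) : 0 < t ->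
  (forall y, derivable g y v) ->
  exists2 s, 0 < s < t & g (x + t *: v) - g x = t * 'D_v g (x + s *: v).
Proof.
move=> t0 dg.
have [||s] := @MVT R (fun s => g (x + s *: v))
  (fun s => 'D_v g (x + s *: v)) _ _ t0.
- by move=> s _; exact: is_derive_line.
- apply: derivable_within_continuous => s _.
  by have [] := is_derive_line (dg (x + s *: v)).
rewrite in_itv /= => st; rewrite scale0r addr0 subr0 => ->.
by exists s => //; rewrite mulrC.
Qed.

(** The second difference is symmetric in u and v, whereas two successive mean
    values, first along u and then along v, evaluate it as a mixed derivative at
    a point close to x; this is what makes [schwarz] work. *)
Lemma mixed_difference g (x u v : V) (t : R) : 0 < t ->
  (forall y, derivable g y u) ->
  (forall y, derivable (fun y => 'D_u g y) y v) ->
  exists s1 s2, [/\ 0 < s1 < t, 0 < s2 < t &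
   g (x + t *: u + t *: v) - g (x + t *: u) - (g (x + t *: v) - g x)
   = t * (t * 'D_v (fun y => 'D_u g y) (x + s1 *: u + s2 *: v))].
Proof.
move=> t0 du dvu.
(* The second difference is the increment of k along t u. *)
pose k y := g (y + t *: v) - g y.
have dgv y : is_derive y u (fun y => g (y + t *: v)) ('D_u g (y + t *: v)).
  have E : (fun h : R => h^-1 *: (g (h *: u + y + t *: v) - g (y + t *: v))) =
           (fun h : R => h^-1 *: (g (h *: u + (y + t *: v)) - g (y + t *: v))).
    by apply/funext => h; rewrite addrA.
  split; first by move: (du (y + t *: v)); rewrite /derivable /shift /= E.
  by rewrite /derive /shift /= E.
have dk y : is_derive y u k ('D_u g (y + t *: v) - 'D_u g y).
  apply: is_deriveB; exact: derivableP.
have [|s1 s1t E1] := @mean_value_line k x u t t0.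
  by move=> y; have [] := dk y.
have [s2 s2t E2] :=
  @mean_value_line (fun y => 'D_u g y) (x + s1 *: u) v t t0 dvu.
exists s1, s2; split => //.
rewrite -E2; have [_ <-] := dk (x + s1 *: u).
by rewrite -E1 /k.
Qed.

Lemma schwarz g (x u v : V) :
  (forall y, derivable g y u) -> (forall y, derivable g y v) ->
  (forall y, derivable (fun y => 'D_u g y) y v) ->
  (forall y, derivable (fun y => 'D_v g y) y u) ->
  continuous (fun y => 'D_v (fun y => 'D_u g y) y) ->
  continuous (fun y => 'D_u (fun y => 'D_v g y) y) ->
  'D_v (fun y => 'D_u g y) x = 'D_u (fun y => 'D_v g y) x.
Proof.
move=> du dv dvu duv cvu cuv.
apply/eqP; rewrite -subr_eq0 -normr_le0.
apply/ler_addgt0Pl => e e0; rewrite addr0.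
have e20 : 0 < e / 2 by rewrite divr_gt0.
have lineE (a b : V) (s1 s2 t : R) : 0 < s1 < t -> 0 < s2 < t ->
    `|s1 *: a + s2 *: b| <= t * (`|a| + `|b|).
  move=> /andP[s10 s1t] /andP[s20 s2t]; rewrite (le_trans (ler_normD _ _))//.
  by rewrite !normrZ !gtr0_norm// mulrDr lerD// ler_wpM2r// ltW.
have near_line (F : V -> R) (a b : V) : {for x, continuous F} ->
    exists2 t, 0 < t & forall t' s1 s2,
      0 < t' <= t -> 0 < s1 < t' -> 0 < s2 < t' ->
      `|F x - F (x + s1 *: a + s2 *: b)| < e / 2.
  move=> /cvgrPdist_lt/(_ _ e20)/nbhs_ballP[r /= r0 rF].
  exists (r / (`|a| + `|b| + 1) / 2).
    by rewrite !divr_gt0// ltr_wpDl// addr_ge0.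
  move=> t' s1 s2 /andP[t'0 t't] s1t s2t; apply: rF.
  rewrite -ball_normE /= -addrA opprD addNKr normrN.
  rewrite (le_lt_trans (lineE _ _ _ _ _ s1t s2t))//.
  have ab : 0 <= `|a| + `|b| by rewrite addr_ge0.
  rewrite (@le_lt_trans _ _ (r / (`|a| + `|b| + 1) / 2 * (`|a| + `|b| + 1)))//.
    by rewrite ler_pM// ?(ltW t'0)// lerDl.
  rewrite mulrAC divfK ?gt_eqF// ?ltr_wpDl//.
  by rewrite ltr_pdivrMr// ltr_pMr// ltr1n.
have [t1 t10 H1] := near_line _ u v (cvu x).
have [t2 t20 H2] := near_line _ v u (cuv x).
pose t := Num.min t1 t2.
have t0 : 0 < t by rewrite lt_min t10.
have [a1 [a2 [a1t a2t Ea]]] := mixed_difference x t0 du dvu.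
have [b1 [b2 [b1t b2t Eb]]] := mixed_difference x t0 dv duv.
have {H1}K1 : _ := H1 t a1 a2 _ a1t a2t.
have {H2}K2 : _ := H2 t b1 b2 _ b1t b2t.
have EE : 'D_v (fun y => 'D_u g y) (x + a1 *: u + a2 *: v)
        = 'D_u (fun y => 'D_v g y) (x + b1 *: v + b2 *: u).
  suff : t * (t * 'D_v (fun y => 'D_u g y) (x + a1 *: u + a2 *: v)) =
    t * (t * 'D_u (fun y => 'D_v g y) (x + b1 *: v + b2 *: u)).
    by move=> /(mulfI (lt0r_neq0 t0))/(mulfI (lt0r_neq0 t0)).
  rewrite -[LHS]Ea -[RHS]Eb (addrAC x (t *: v)) !opprB [LHS]addrACA.
  by rewrite [- g _ + _]addrC -addrACA.
have k1 : `|'D_v (fun y => 'D_u g y) x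
    - 'D_v (fun y => 'D_u g y) (x + a1 *: u + a2 *: v)| < e / 2.
  by apply: K1; rewrite t0 ge_min lexx.
have k2 : `|'D_u (fun y => 'D_v g y) x
    - 'D_u (fun y => 'D_v g y) (x + b1 *: v + b2 *: u)| < e / 2.
  by apply: K2; rewrite t0 ge_min lexx orbT.
rewrite EE in k1.
apply: ltW; exact: dist_half k1 k2.
Qed.

Lemma derivable_partialD r g k x : derivable g x (delta_mx r ord0) ->
  derivable k x (delta_mx r ord0) ->
  partial r (fun y => g y + k y) x = partial r g x + partial r k x.
Proof. exact: deriveD. Qed.

Lemma derivable_partialM r g k x : derivable g x (delta_mx r ord0) ->
  derivable k x (delta_mx r ord0) ->
  partial r (fun y => g y * k y) x = g x * partial r k x + k x * partial r g x.
Proof. exact: deriveM. Qed.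

Lemma CkW n g : Ck n.+1 g -> Ck n g.
Proof.
elim: n g => [g []//|n IH g [cg dg pg]]; split => // r.
exact: IH.
Qed.

Lemma Ck_cst n (c : R) : Ck n (fun _ : V => c).
Proof.
elim: n c => [|n IH] c /=; first exact: cst_continuous.
split; first exact: cst_continuous.
- by move=> r x; exact: derivable_cst.
- move=> r; have -> : partial r (fun _ : V => c) = fun=> 0.
    by apply/funext => x; exact: derive_cst.
  exact: IH.
Qed.

Lemma CkD n g k : Ck n g -> Ck n k -> Ck n (fun x => g x + k x).
Proof.
elim: n g k => [|n IH] g k /=.
  by move=> cg ck x; exact: (cvgD (cg x) (ck x)).
move=> [cg dg pg] [ck dk pk].
split; first by move=> x; exact: (cvgD (cg x) (ck x)).
- by move=> r x; exact: derivableD.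
- move=> r; have -> : partial r (fun x => g x + k x) =
      fun x => partial r g x + partial r k x.
    by apply/funext => x; exact: derivable_partialD.
  exact: IH.
Qed.

Lemma CkM n g k : Ck n g -> Ck n k -> Ck n (fun x => g x * k x).
Proof.
elim: n g k => [|n IH] g k.
  by move=> cg ck x; exact: (cvgM (cg x) (ck x)).
move=> sg sk; have [cg dg pg] := sg; have [ck dk pk] := sk.
split; first by move=> x; exact: (cvgM (cg x) (ck x)).
- by move=> r x; exact: derivableM.
- move=> r; have -> : partial r (fun x => g x * k x) =
      fun x => g x * partial r k x + k x * partial r g x.
    by apply/funext => x; exact: derivable_partialM.
  exact: CkD (IH _ _ (CkW sg) (pk r)) (IH _ _ (CkW sk) (pg r)).
Qed.

Lemma CkV n g : (forall x, g x != 0) -> Ck n g -> Ck n (fun x => (g x)^-1).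
Proof.
move=> g0; elim: n => [|n IH]; first by move=> cg x; exact: cvgV (g0 x) (cg x).
move=> sg; have [cg dg pg] := sg.
split; first by move=> x; exact: cvgV (g0 x) (cg x).
- by move=> r x; exact: derivableV.
- move=> r; have -> : partial r (fun x => (g x)^-1) =
      fun x => (-1 * partial r g x) * ((g x)^-1 * (g x)^-1).
    apply/funext => x; rewrite /partial deriveV//.
    by rewrite /GRing.scale /= -exprVn expr2 mulN1r mulrC mulrN mulNr mulrC.
  have gV := IH (CkW sg).
  exact: CkM (CkM (Ck_cst _ _) (pg r)) (CkM gV gV).
Qed.

(** The one-variable chain rule on a line: derivability along v alone does not
    allow a chain rule for differentials. *)
Lemma is_derive_ln g x v : derivable g x v -> 0 < g x ->
  is_derive x v (fun y => ln (g y)) ('D_v g x / g x).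
Proof.
move=> dg g0.
have D0 : is_derive (0:R) 1 (fun s : R => g (x + s *: v)) ('D_v g x).
  by have := @is_derive_line g x v 0; rewrite scale0r addr0; apply.
have D1 : is_derive (g (x + 0 *: v)) 1 (@ln R) (g x)^-1.
  by rewrite scale0r addr0; exact: is_derive1_ln.
have [d1 d2] := is_derive1_comp D1 D0.
have EE : (fun h : R =>
      h^-1 *: (ln (g (x + (h *: 1 + 0) *: v)) - ln (g (x + 0 *: v)))) =
    (fun h : R => h^-1 *: (ln (g (h *: v + x)) - ln (g x))).
  by apply/funext => h; rewrite [h *: 1]mulr1 addr0 scale0r addr0 [x + _]addrC.
split; first by move: d1; rewrite /derivable /shift /= EE.
rewrite mulrC -d2 /derive /shift /= EE//.
Qed.

End Smooth.

Section SmoothRules.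
Context (R : realType) (d : nat).
Local Notation V := ('cV[R]_d).
Implicit Types (g k : V -> R) (W F G : V -> V).

Lemma smooth_continuous g : smooth g -> continuous g.
Proof. by move=> /(_ 0%N). Qed.

Lemma smooth_derivable g r x : smooth g -> derivable g x (delta_mx r ord0).
Proof. by move=> /(_ 1%N)[_ dg _]; exact: dg. Qed.

Lemma smooth_partial r g : smooth g -> smooth (partial r g).
Proof. by move=> sg n; have [_ _ pg] := sg n.+1; exact: pg. Qed.

Lemma smooth_cst (c : R) : smooth (fun _ : V => c).
Proof. by move=> n; exact: Ck_cst. Qed.

Lemma smoothD g k : smooth g -> smooth k -> smooth (fun x => g x + k x).
Proof. by move=> sg sk n; exact: CkD. Qed.

Lemma smoothM g k : smooth g -> smooth k -> smooth (fun x => g x * k x).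
Proof. by move=> sg sk n; exact: CkM. Qed.

Lemma smoothN g : smooth g -> smooth (fun x => - g x).
Proof.
move=> sg; under eq_fun do rewrite -mulN1r.
exact: smoothM (smooth_cst _) sg.
Qed.

Lemma smoothB g k : smooth g -> smooth k -> smooth (fun x => g x - k x).
Proof. by move=> sg sk; exact: smoothD sg (smoothN sk). Qed.

Lemma smoothV g : (forall x, g x != 0) -> smooth g -> smooth (fun x => (g x)^-1).
Proof. by move=> g0 sg n; exact: CkV. Qed.

Lemma smooth_sum (I : Type) (s : seq I) (P : pred I) (g : I -> V -> R) :
  (forall i, P i -> smooth (g i)) -> smooth (fun x => \sum_(i <- s | P i) g i x).
Proof.
move=> sg; elim: s => [|i s IH].
  by under eq_fun do rewrite big_nil; exact: smooth_cst.
under eq_fun do rewrite big_cons.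
by case: (P i) (sg i) => // sgi; exact: smoothD (sgi isT) IH.
Qed.

Lemma partial_cst r (c : R) x : partial r (fun _ : V => c) x = 0.
Proof. exact: derive_cst. Qed.

Lemma partialD r g k x : smooth g -> smooth k ->
  partial r (fun y => g y + k y) x = partial r g x + partial r k x.
Proof. by move=> sg sk; apply: derivable_partialD; exact: smooth_derivable. Qed.

Lemma partialM r g k x : smooth g -> smooth k ->
  partial r (fun y => g y * k y) x = g x * partial r k x + k x * partial r g x.
Proof. by move=> sg sk; apply: derivable_partialM; exact: smooth_derivable. Qed.

Lemma partial_sum r (I : Type) (s : seq I) (P : pred I) (g : I -> V -> R) x :
  (forall i, P i -> smooth (g i)) ->
  partial r (fun y => \sum_(i <- s | P i) g i y) x
  = \sum_(i <- s | P i) partial r (g i) x.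
Proof.
move=> sg; elim: s => [|i s IH].
  by under eq_fun do rewrite big_nil; rewrite big_nil partial_cst.
under eq_fun do rewrite big_cons; rewrite big_cons.
case: (P i) (sg i) => // sgi; rewrite partialD ?IH//; first exact: sgi.
exact: smooth_sum.
Qed.

Lemma partialC r s g x : smooth g ->
  partial r (partial s g) x = partial s (partial r g) x.
Proof.
move=> sg; apply: schwarz.
- by move=> y; exact: smooth_derivable.
- by move=> y; exact: smooth_derivable.
- by move=> y; apply: (@smooth_derivable (partial s g)); exact: smooth_partial.
- by move=> y; apply: (@smooth_derivable (partial r g)); exact: smooth_partial.
- apply: (@smooth_continuous (partial r (partial s g))).
  by do 2!apply: smooth_partial.
- apply: (@smooth_continuous (partial s (partial r g))).
  by do 2!apply: smooth_partial.
Qed.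

Lemma partial_ln r g x : derivable g x (delta_mx r ord0) -> 0 < g x ->
  partial r (fun y => ln (g y)) x = partial r g x / g x.
Proof. by move=> dg g0; have [_] := is_derive_ln dg g0. Qed.

Lemma smooth_ln g : (forall x, 0 < g x) -> smooth g -> smooth (fun x => ln (g x)).
Proof.
move=> g0 sg; have g00 x : g x != 0 by rewrite gt_eqF.
have cln : continuous (fun x => ln (g x)).
  move=> x; apply: continuous_comp; first exact: smooth_continuous.
  exact: continuous_ln.
case => [|n] //=; split => //.
  move=> r x; have dg := @smooth_derivable g r x sg.
  by have [] := is_derive_ln dg (g0 x).
move=> r; have -> : partial r (fun x => ln (g x)) =
    fun x => partial r g x * (g x)^-1.
  by apply/funext => x; apply: partial_ln => //; exact: smooth_derivable.
exact: (smoothM (smooth_partial r sg) (smoothV g00 sg)).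
Qed.

(** Regularity of g is bootstrapped from the equation for its logarithmic
    derivative: each application gains one order. It upgrades the invariant
    density, of class C^2 only, to a smooth function. *)
Lemma smooth_log_derivative g q : continuous g ->
  (forall r x, derivable g x (delta_mx r ord0)) -> smooth q ->
  (forall r x, partial r g x = g x * partial r q x) -> smooth g.
Proof.
move=> cg dg sq gq; elim => [//|n IH]; split => // r.
have -> : partial r g = fun x => g x * partial r q x by exact/funext.
exact: CkM IH (smooth_partial r sq n).
Qed.

Lemma smooth_mx_mulmx (p q s : nat) (M : V -> 'M[R]_(p, q)) (N : V -> 'M[R]_(q, s)) :
  smooth_mx M -> smooth_mx N -> smooth_mx (fun x => M x *m N x).
Proof.
move=> sM sN i j; under eq_fun do rewrite mxE.
by apply: smooth_sum => l _; exact: smoothM (sM i l) (sN l j).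
Qed.

Lemma smooth_mx_tr (p q : nat) (M : V -> 'M[R]_(p, q)) :
  smooth_mx M -> smooth_mx (fun x => (M x)^T).
Proof. by move=> sM i j; under eq_fun do rewrite mxE; exact: sM. Qed.

Lemma smooth_mxD (p q : nat) (M N : V -> 'M[R]_(p, q)) :
  smooth_mx M -> smooth_mx N -> smooth_mx (fun x => M x + N x).
Proof.
move=> sM sN i j; under eq_fun do rewrite mxE.
exact: smoothD (sM i j) (sN i j).
Qed.

Lemma smooth_mxN (p q : nat) (M : V -> 'M[R]_(p, q)) :
  smooth_mx M -> smooth_mx (fun x => - M x).
Proof. by move=> sM i j; under eq_fun do rewrite mxE; exact: smoothN (sM i j). Qed.

Lemma smooth_mxB (p q : nat) (M N : V -> 'M[R]_(p, q)) :
  smooth_mx M -> smooth_mx N -> smooth_mx (fun x => M x - N x).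
Proof. by move=> sM sN; exact: smooth_mxD sM (smooth_mxN sN). Qed.

Lemma smooth_mxZ (p q : nat) g (M : V -> 'M[R]_(p, q)) :
  smooth g -> smooth_mx M -> smooth_mx (fun x => g x *: M x).
Proof.
move=> sg sM i j; under eq_fun do rewrite mxE.
exact: smoothM sg (sM i j).
Qed.

Lemma smooth_partial_mx (p q : nat) r (M : V -> 'M[R]_(p, q)) :
  smooth_mx M -> smooth_mx (partial_mx r M).
Proof.
by move=> sM i j; under eq_fun do rewrite mxE; exact: smooth_partial (sM i j).
Qed.

Lemma smooth_gram (k : nat) (c : V -> 'M[R]_(d, k)) : smooth_mx c -> smooth_mx (gram c).
Proof. by move=> sc; exact: smooth_mx_mulmx sc (smooth_mx_tr sc). Qed.

Lemma smooth_cfield (k : nat) (c : V -> 'M[R]_(d, k)) i :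
  smooth_mx c -> smooth_mx (cfield c i).
Proof. by move=> sc r j; under eq_fun do rewrite mxE; exact: sc. Qed.

Lemma smooth_dot F G : smooth_mx F -> smooth_mx G ->
  smooth (fun x => dot (F x) (G x)).
Proof. by move=> sF sG; apply: smooth_sum => r _; exact: smoothM (sF r _) (sG r _). Qed.

Lemma smooth_grad g : smooth g -> smooth_mx (grad g).
Proof.
by move=> sg r j; under eq_fun do rewrite mxE; exact: smooth_partial.
Qed.

Lemma smooth_divg F : smooth_mx F -> smooth (divg F).
Proof. by move=> sF; apply: smooth_sum => r _; exact: smooth_partial (sF r _). Qed.

Lemma smooth_dir W g : smooth_mx W -> smooth g -> smooth (dir W g).
Proof.
move=> sW sg; apply: smooth_sum => r _.
exact: smoothM (sW _ _) (smooth_partial r sg).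
Qed.

Lemma vdirE W F x r : vdir W F x r ord0 = dir W (fun y => F y r ord0) x.
Proof. by rewrite summxE; apply: eq_bigr => s _; rewrite !mxE. Qed.

Lemma smooth_vdir W F : smooth_mx W -> smooth_mx F -> smooth_mx (vdir W F).
Proof.
move=> sW sF r j; rewrite ord1; under eq_fun do rewrite vdirE.
exact: smooth_dir.
Qed.

Lemma smooth_lie W F : smooth_mx W -> smooth_mx F -> smooth_mx (lie_bracket W F).
Proof.
by move=> sW sF; apply: smooth_mxB; exact: smooth_vdir.
Qed.

End SmoothRules.

Ltac smooth :=
  repeat first
  [ assumption
  | match goal with
    | |- smooth (fun _ => ?c) => exact: smooth_cst
    | |- forall j, Ck j ?g => change (smooth g)
    | |- smooth (partial _ _) => apply: smooth_partial
    | |- smooth (divg _) => apply: smooth_divg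
    | |- smooth (dir _ _) => apply: smooth_dir
    | |- smooth (fun y => partial _ _ y) => apply: smooth_partial
    | |- smooth (fun y => divg _ y) => apply: smooth_divg
    | |- smooth (fun y => dir _ _ y) => apply: smooth_dir
    | |- smooth (fun y => dot _ _) => apply: smooth_dot
    | |- smooth (fun y => (_ - _)%R) => apply: smoothB
    | |- smooth (fun y => (_ + _)%R) => apply: smoothD
    | |- smooth (fun y => (- _)%R) => apply: smoothN
    | |- smooth (fun y => (_ * _)%R) => apply: smoothM
    | |- smooth (fun y => bigop _ _ _) => apply: smooth_sum => ? ?
    | |- smooth_mx (vdir _ _) => apply: smooth_vdir
    | |- smooth_mx (lie_bracket _ _) => apply: smooth_lie
    | |- smooth_mx (grad _) => apply: smooth_grad
    | |- smooth_mx (gram _) => apply: smooth_gram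
    | |- smooth_mx (cfield _ _) => apply: smooth_cfield
    | |- smooth_mx (partial_mx _ _) => apply: smooth_partial_mx
    | |- smooth_mx (fun y => vdir _ _ y) => apply: smooth_vdir
    | |- smooth_mx (fun y => lie_bracket _ _ y) => apply: smooth_lie
    | |- smooth_mx (fun y => grad _ y) => apply: smooth_grad
    | |- smooth_mx (fun y => gram _ y) => apply: smooth_gram
    | |- smooth_mx (fun y => cfield _ _ y) => apply: smooth_cfield
    | |- smooth_mx (fun y => partial_mx _ _ y) => apply: smooth_partial_mx
    | |- smooth_mx (fun y => (_ *m _)%R) => apply: smooth_mx_mulmx
    | |- smooth_mx (fun y => (_ - _)%R) => apply: smooth_mxB
    | |- smooth_mx (fun y => (_ + _)%R) => apply: smooth_mxD
    | |- smooth_mx (fun y => (- _)%R) => apply: smooth_mxN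
    | |- smooth_mx (fun y => (_ *: _)%R) => apply: smooth_mxZ
    | |- smooth_mx (fun y => (_ ^T)%R) => apply: smooth_mx_tr
    | H : smooth_mx ?M |- smooth (fun y => fun_of_matrix (?M y) _ _) => exact: H
    end ].

(** * Vector fields as derivations *)

Section VectorFields.
Context (R : realType) (d : nat).
Local Notation V := ('cV[R]_d).
Implicit Types (g k : V -> R) (W F G : V -> V) (u v w : V).

Lemma dotC u v : dot u v = dot v u.
Proof. by apply: eq_bigr => r _; rewrite mulrC. Qed.

Lemma dotDl u v w : dot (u + v) w = dot u w + dot v w.
Proof. by rewrite -big_split; apply: eq_bigr => r _; rewrite mxE mulrDl. Qed.

Lemma dotZl (s : R) u v : dot (s *: u) v = s * dot u v.
Proof. by rewrite mulr_sumr; apply: eq_bigr => r _; rewrite mxE mulrA. Qed.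

Lemma dotBl u v w : dot (u - v) w = dot u w - dot v w.
Proof. by rewrite dotDl -scaleN1r dotZl mulN1r. Qed.

Lemma dot0l v : dot 0 v = 0.
Proof. by rewrite -(scale0r 0) dotZl mul0r. Qed.

Lemma dot_suml (I : Type) (s : seq I) (P : pred I) (F : I -> V) v :
  dot (\sum_(i <- s | P i) F i) v = \sum_(i <- s | P i) dot (F i) v.
Proof.
apply: (big_morph (fun u => dot u v)); last exact: dot0l.
by move=> ? ?; exact: dotDl.
Qed.

(** In [dir_square_comm] the iterated field F (C F) occurs with both signs and
    cancels here; abstract vectors keep iterated derivatives from being unfolded. *)
Lemma dot_telescope u v w z (s : R) :
  dot (u - v) z + s + (dot (w - u) z + s) = dot (w - v) z + 2 * s.
Proof. by rewrite !dotBl; ring. Qed.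

Lemma dirE W g x : dir W g x = dot (W x) (grad g x).
Proof. by apply: eq_bigr => r _; rewrite mxE. Qed.

Lemma dirD W g k x : smooth g -> smooth k ->
  dir W (fun y => g y + k y) x = dir W g x + dir W k x.
Proof.
move=> sg sk; rewrite -big_split; apply: eq_bigr => r _.
by rewrite partialD// mulrDr.
Qed.

Lemma dirM W g k x : smooth g -> smooth k ->
  dir W (fun y => g y * k y) x = g x * dir W k x + k x * dir W g x.
Proof.
move=> sg sk; rewrite !mulr_sumr -big_split; apply: eq_bigr => r _ /=.
by rewrite partialM//; ring.
Qed.

Lemma dir_cst W (c : R) x : dir W (fun _ => c) x = 0.
Proof. by rewrite [LHS]big1// => r _; rewrite partial_cst mulr0. Qed.

Lemma dirZ W (c : R) g x : smooth g ->
  dir W (fun y => c * g y) x = c * dir W g x.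
Proof.
by move=> sg; rewrite dirM// ?dir_cst ?mulr0 ?addr0//; exact: smooth_cst.
Qed.

Lemma dir_sum W (I : Type) (s : seq I) (P : pred I) (g : I -> V -> R) x :
  (forall i, P i -> smooth (g i)) ->
  dir W (fun y => \sum_(i <- s | P i) g i y) x
  = \sum_(i <- s | P i) dir W (g i) x.
Proof.
move=> sg; rewrite /dir exchange_big/=; apply: eq_bigr => r _.
by rewrite partial_sum// mulr_sumr.
Qed.

Lemma divgZ g F x : smooth g -> smooth_mx F ->
  divg (fun y => g y *: F y) x = g x * divg F x + dir F g x.
Proof.
move=> sg sF; rewrite mulr_sumr -big_split; apply: eq_bigr => r _ /=.
under eq_fun do rewrite mxE.
by rewrite partialM; [|smooth..].
Qed.

Lemma divg_sum (I : Type) (s : seq I) (P : pred I) (F : I -> V -> V) x :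
  (forall i, P i -> smooth_mx (F i)) ->
  divg (fun y => \sum_(i <- s | P i) F i y) x = \sum_(i <- s | P i) divg (F i) x.
Proof.
move=> sF; rewrite exchange_big/=; apply: eq_bigr => r _.
under eq_fun do rewrite summxE.
by rewrite partial_sum// => i Pi; exact: sF.
Qed.

(** The bilinear form of second derivatives, in the index order of QX and PX. *)
Definition hess g x u v : R :=
  \sum_r \sum_s u r ord0 * v s ord0 * partial r (partial s g) x.

Lemma hessE g x u v : hess g x u v = dot v (\col_s dir (fun=> u) (partial s g) x).
Proof.
rewrite /hess exchange_big/=; apply: eq_bigr => s _; rewrite mxE mulr_sumr.
by apply: eq_bigr => r _; ring.
Qed.

Lemma hessC g x u v : smooth g -> hess g x u v = hess g x v u.
Proof.
move=> sg; rewrite /hess exchange_big/=; apply: eq_bigr => s _.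
by apply: eq_bigr => r _; rewrite partialC//; ring.
Qed.

Lemma hessDr g x u v w : hess g x u (v + w) = hess g x u v + hess g x u w.
Proof. by rewrite !hessE dotDl. Qed.

Lemma hessZr g x u (s : R) v : hess g x u (s *: v) = s * hess g x u v.
Proof. by rewrite !hessE dotZl. Qed.

Lemma hess_sumr g x u (I : Type) (s : seq I) (P : pred I) (F : I -> V) :
  hess g x u (\sum_(i <- s | P i) F i) = \sum_(i <- s | P i) hess g x u (F i).
Proof. by rewrite hessE dot_suml; apply: eq_bigr => i _; rewrite hessE. Qed.

(** The Leibniz rule behind every formula below: differentiating a first-order
    operator F.grad along W produces a first-order part, in which W acts on the
    coefficients of F, and a second-order part, the Hessian at (W, F). *)
Lemma dir_dot_grad W F g x : smooth_mx F -> smooth g ->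
  dir W (fun y => dot (F y) (grad g y)) x
  = dot (vdir W F x) (grad g x) + hess g x (W x) (F x).
Proof.
move=> sF sg; rewrite dir_sum; last first.
  by move=> r _; apply: smoothM; [|exact: smooth_grad].
rewrite hessE -big_split; apply: eq_bigr => s _ /=.
rewrite dirM; [|by []|exact: smooth_grad].
have -> : (fun y => grad g y s ord0) = partial s g by apply/funext => y; rewrite mxE.
by rewrite vdirE !mxE addrC [partial s g x * _]mulrC.
Qed.

Lemma dir_dir W F g x : smooth_mx F -> smooth g ->
  dir W (dir F g) x = dot (vdir W F x) (grad g x) + hess g x (W x) (F x).
Proof.
move=> sF sg; rewrite -dir_dot_grad//; congr dir.
by apply/funext => y; rewrite dirE.
Qed.

(** Symmetry of the Hessian makes the second-order parts cancel. *)
Lemma dir_lie W F g x : smooth_mx W -> smooth_mx F -> smooth g ->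
  dir W (dir F g) x - dir F (dir W g) x = dir (lie_bracket W F) g x.
Proof.
move=> sW sF sg; rewrite !dir_dir// dirE dotBl [hess g x (F x) _]hessC//; ring.
Qed.

Lemma vdir_lie W F G x : smooth_mx W -> smooth_mx F -> smooth_mx G ->
  vdir W (vdir F G) x - vdir F (vdir W G) x = vdir (lie_bracket W F) G x.
Proof.
move=> sW sF sG; apply/colP => r; rewrite !mxE !vdirE -dir_lie//.
have E H K : (fun y => vdir H K y r ord0) = dir H (fun y => K y r ord0).
  by apply/funext => y; rewrite vdirE.
by rewrite !E.
Qed.

Lemma vdirBr W F G x : smooth_mx F -> smooth_mx G ->
  vdir W (fun y => F y - G y) x = vdir W F x - vdir W G x.
Proof.
move=> sF sG; apply/colP => r; rewrite !mxE !vdirE.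
under eq_fun do rewrite !mxE -mulN1r.
by rewrite dirD ?dirZ ?mulN1r//; apply: smoothM => //; exact: smooth_cst.
Qed.

End VectorFields.

(** Abstracts the scalars built from vector fields, so that the decision
    procedures compare names instead of unfolding derivatives. *)
Ltac field_atoms :=
  repeat match goal with
  | |- context [hess ?g ?x ?u ?v] => generalize (hess g x u v) => ?
  | |- context [dot ?u ?v] => generalize (dot u v) => ?
  | |- context [dir ?W ?g ?x] => generalize (dir W g x) => ?
  | |- context [divg ?W ?x] => generalize (divg W x) => ?
  end.

(** * Gamma operators of a frame of vector fields *)

Section Frames.
Context (R : realType) (d : nat).
Local Notation V := ('cV[R]_d).
Implicit Types (f g : V -> R) (W F G : V -> V) (u v w : V).

Lemma mulmx_gram (k : nat) (M N : 'M[R]_(d, k)) v :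
  (M *m N^T) *m v = \sum_i dot (col i N) v *: col i M.
Proof.
apply/colP => r; rewrite -mulmxA mxE summxE; apply: eq_bigr => i _.
rewrite !mxE mulrC; congr (_ * _); apply: eq_bigr => s _; by rewrite !mxE.
Qed.

Lemma gramE (k : nat) (c : V -> 'M[R]_(d, k)) x v :
  gram c x *m v = \sum_i dot (cfield c i x) v *: cfield c i x.
Proof. exact: mulmx_gram. Qed.

Lemma partial_gram (k : nat) (c : V -> 'M[R]_(d, k)) r x : smooth_mx c ->
  partial_mx r (gram c) x
  = partial_mx r c x *m (c x)^T + c x *m (partial_mx r c x)^T.
Proof.
move=> sc; apply/matrixP => i j; rewrite !mxE -big_split/=.
have -> : (fun y => gram c y i j) = fun y => \sum_l c y i l * c y j l.
  apply/funext => y; rewrite mxE; apply: eq_bigr => l _; by rewrite !mxE.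
rewrite partial_sum; last by move=> l _; exact: smoothM.
apply: eq_bigr => l _; rewrite partialM//.
by rewrite !mxE addrC [c x j l * _]mulrC.
Qed.

(** Differentiating the two factors of c c^T gives the same scalar once both
    sides are paired with u, hence the factor 2. *)
Lemma sum_partial_gram (k : nat) (c : V -> 'M[R]_(d, k)) W x u : smooth_mx c ->
  \sum_r W x r ord0 * dot u (partial_mx r (gram c) x *m u)
  = 2 * \sum_i dot (vdir W (cfield c i) x) u * dot (cfield c i x) u.
Proof.
move=> sc; have colE r i : col i (partial_mx r c x) = partial_mx r (cfield c i) x.
  apply/colP => s; rewrite !mxE; congr (partial _ _ _).
  by apply/funext => y; rewrite mxE.
transitivity (\sum_r \sum_i 2 *
  (W x r ord0 * dot (partial_mx r (cfield c i) x) u * dot (cfield c i x) u)).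
  apply: eq_bigr => r _; rewrite partial_gram// mulmxDl dotC dotDl !mulmx_gram.
  rewrite !dot_suml -big_split mulr_sumr; apply: eq_bigr => i _ /=.
  rewrite !dotZl colE /cfield; ring.
rewrite exchange_big mulr_sumr/=; apply: eq_bigr => i _.
by rewrite -mulr_sumr dot_suml mulr_suml; under [in RHS]eq_bigr do rewrite dotZl.
Qed.

Lemma Gamma1E (k : nat) (c : V -> 'M[R]_(d, k)) f g x :
  Gamma1 c f g x = \sum_i dir (cfield c i) f x * dir (cfield c i) g x.
Proof.
apply: eq_bigr => i _; rewrite !dirE.
have E h : ((c x)^T *m grad h x) i ord0 = dot (cfield c i x) (grad h x).
  by rewrite mxE; apply: eq_bigr => r _; rewrite !mxE.
by rewrite !E.
Qed.

Lemma smooth_Gamma1 (k : nat) (c : V -> 'M[R]_(d, k)) f g :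
  smooth_mx c -> smooth f -> smooth g -> smooth (Gamma1 c f g).
Proof.
move=> sc sf sg; have -> : Gamma1 c f g =
    fun x => \sum_i dir (cfield c i) f x * dir (cfield c i) g x.
  by apply/funext => x; exact: Gamma1E.
by smooth.
Qed.

Section Generator.
Context (n : nat) (a : V -> 'M[R]_(d, n)) (pi : V -> R).
Hypotheses (sa : smooth_mx a) (sq : smooth (fun x => ln (pi x))).
Local Notation A := (cfield a).
Local Notation h := (fun x => gram a x *m gradlog pi x).
Local Notation L := (gen a pi).

Lemma smooth_gram_gradlog : smooth_mx h.
Proof. by rewrite /gradlog; smooth. Qed.

(** Hormander form of the generator: a sum of squares of the fields A_i plus a
    first-order operator. *)
Lemma genE g x : smooth g ->
  L g x = \sum_i (dir (A i) (dir (A i) g) x + divg (A i) x * dir (A i) g x)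
          + dir h g x.
Proof.
move=> sg; rewrite /gen -(dirE h g x); congr +%R.
have -> : (fun y => gram a y *m grad g y) =
    fun y => \sum_i dir (A i) g y *: A i y.
  by apply/funext => y; rewrite gramE; apply: eq_bigr => i _; rewrite dirE.
rewrite divg_sum; last by move=> i _; smooth.
by apply: eq_bigr => i _; rewrite divgZ; [rewrite addrC mulrC|smooth..].
Qed.

Lemma smooth_gen g : smooth g -> smooth (L g).
Proof.
move=> sg; have -> : L g = fun x =>
    \sum_i (dir (A i) (dir (A i) g) x + divg (A i) x * dir (A i) g x) + dir h g x.
  by apply/funext => x; exact: genE.
by have sh := smooth_gram_gradlog; smooth.
Qed.

(** For a second-order operator, L (u^2) / 2 exceeds u L u exactly by the sum of
    the squares (A_i u)^2. *)
Lemma gen_sum_squares (k : nat) (u : 'I_k -> V -> R) x :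
  (forall j, smooth (u j)) ->
  2^-1 * L (fun y => \sum_j u j y * u j y) x
  = \sum_j (u j x * L (u j) x + \sum_i dir (A i) (u j) x ^+ 2).
Proof.
move=> su; have D W : dir W (fun y => \sum_j u j y * u j y) =
    fun y => \sum_j 2 * (u j y * dir W (u j) y).
  apply/funext => y; rewrite dir_sum; last by move=> j _; smooth.
  by apply: eq_bigr => j _; rewrite dirM//; ring.
rewrite genE; last by smooth.
under [in RHS]eq_bigr do rewrite genE// mulrDr mulr_sumr.
rewrite D.
transitivity (\sum_j (\sum_i u j x * (dir (A i) (dir (A i) (u j)) x
     + divg (A i) x * dir (A i) (u j) x) + \sum_i dir (A i) (u j) x ^+ 2
     + u j x * dir h (u j) x)); last first.
  by apply: eq_bigr => j _; rewrite addrAC.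
rewrite [in RHS]big_split/= [LHS]mulrDr; congr +%R; last first.
  by rewrite mulr_sumr; apply: eq_bigr => j _; rewrite mulKf ?pnatr_eq0.
under [in RHS]eq_bigr do rewrite -big_split.
rewrite mulr_sumr exchange_big/=; apply: eq_bigr => i _.
rewrite D dir_sum; last by move=> j _; smooth.
rewrite [divg _ x * _]mulr_sumr -big_split mulr_sumr; apply: eq_bigr => j _ /=.
rewrite dirZ ?dirM; [|by smooth..].
by field.
Qed.

(** [A^2, C] = A [A, C] + [A, C] A: the commutator has order two, and its
    second-order part is twice the Hessian at (A, [A, C]). Third derivatives
    of g never have to be expanded. *)
Lemma dir_square_comm C F g x : smooth_mx C -> smooth_mx F -> smooth g ->
  dir F (dir F (dir C g)) x - dir C (dir F (dir F g)) x
  = dot (vdir F (vdir F C) x - vdir C (vdir F F) x) (grad g x)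
    + 2 * hess g x (F x) (lie_bracket F C x).
Proof.
move=> sC sF sg.
have E k : smooth k -> dir F (dir C k) =
    fun y => dir C (dir F k) y + dir (lie_bracket F C) k y.
  by move=> sk; apply/funext => y; rewrite -dir_lie// addrC subrK.
rewrite E// dirD; [|by smooth..].
rewrite E; last by smooth.
rewrite addrAC [X in X - _]addrC addrK [X in X + _]dir_dir; [|by smooth..].
rewrite [X in _ + X]dir_dir; [|by smooth..].
rewrite hessC// -vdir_lie// vdirBr; [|by smooth..].
exact: dot_telescope.
Qed.

Lemma gen_comm C g x : smooth_mx C -> smooth g ->
  L (dir C g) x - dir C (L g) x
  = \sum_i (dot (vdir (A i) (vdir (A i) C) x - vdir C (vdir (A i) (A i)) x) (grad g x)
            + 2 * hess g x (A i x) (lie_bracket (A i) C x)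
            + divg (A i) x * dot (lie_bracket (A i) C x) (grad g x)
            - dir C (divg (A i)) x * dot (A i x) (grad g x))
    + dot (vdir h C x - vdir C h x) (grad g x).
Proof.
move=> sC sg; have sh := smooth_gram_gradlog; have LE : L g = fun x =>
    \sum_i (dir (A i) (dir (A i) g) x + divg (A i) x * dir (A i) g x) + dir h g x.
  by apply/funext => y; exact: genE.
rewrite LE genE; last by smooth.
rewrite dirD; [|by smooth..].
rewrite opprD addrACA; congr +%R; last first.
  by rewrite dir_lie// dirE.
rewrite dir_sum; last by move=> i _; smooth.
rewrite -sumrB; apply: eq_bigr => i _.
have sAi : smooth_mx (A i) by smooth.
rewrite dirD; [|by smooth..].
rewrite dirM; [|by smooth..].
rewrite -dir_square_comm// -!dirE -dir_lie//; field_atoms; ring.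
Qed.

End Generator.
End Frames.

(** * Bochner identity and weighted divergences *)

Section DoubleSums.
Context (R : realType) (n m : nat).
Implicit Types F G : 'I_n -> 'I_m -> R.

Lemma sum2D F G : \sum_i \sum_j (F i j + G i j)
  = \sum_i \sum_j F i j + \sum_i \sum_j G i j.
Proof. by rewrite -big_split; apply: eq_bigr => i _; rewrite big_split. Qed.

Lemma sum2B F G : \sum_i \sum_j (F i j - G i j)
  = \sum_i \sum_j F i j - \sum_i \sum_j G i j.
Proof. by rewrite -sumrB; apply: eq_bigr => i _; rewrite sumrB. Qed.

Lemma sum2Z (c : R) F : \sum_i \sum_j (c * F i j) = c * \sum_i \sum_j F i j.
Proof. by rewrite mulr_sumr; apply: eq_bigr => i _; rewrite mulr_sumr. Qed.

Lemma eq_sum2 F G : (forall i j, F i j = G i j) ->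
  \sum_i \sum_j F i j = \sum_i \sum_j G i j.
Proof. by move=> FG; apply: eq_bigr => i _; apply: eq_bigr => j _. Qed.
End DoubleSums.

Section Bochner.
Context (R : realType) (d n k : nat).
Local Notation V := ('cV[R]_d).
Variables (a : V -> 'M[R]_(d, n)) (c : V -> 'M[R]_(d, k)) (pi f : V -> R).
Hypotheses (sa : smooth_mx a) (sc : smooth_mx c).
Hypotheses (sq : smooth (fun x => ln (pi x))) (sf : smooth f).
Local Notation A := (cfield a).
Local Notation C := (cfield c).
Local Notation h := (fun x => gram a x *m gradlog pi x).
Local Notation U x := (grad f x).

(** The part of the commutators [L, C_k] free of second derivatives of f, paired
    with the C_k; R_a and R_z are the cases c = a and c = z. *)
Definition bochner_form (x u : V) : R :=
  \sum_i \sum_k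
    dot (vdir (A i) (vdir (A i) (C k)) x - vdir (C k) (vdir (A i) (A i)) x) u
    * dot (C k x) u
  + \sum_k dot (vdir h (C k) x - vdir (C k) h x) u * dot (C k x) u
  + \sum_i \sum_k
      divg (A i) x * dot (vdir (A i) (C k) x - vdir (C k) (A i) x) u
      * dot (C k x) u
  - \sum_i \sum_k dir (C k) (divg (A i)) x * dot (A i x) u * dot (C k x) u.

(** Since Gamma1 is the sum of the squares of the C_k f, the sum-of-squares rule
    leaves the squares of A_i C_k f and the commutators [L, C_k] f paired with
    C_k f. *)
Lemma bochner x :
  2^-1 * gen a pi (Gamma1 c f f) x - Gamma1 c (gen a pi f) f x
  = \sum_i \sum_k (hess f x (A i x) (C k x) + dot (vdir (A i) (C k) x) (U x)) ^+ 2
    + 2 * \sum_i \sum_k hess f x (A i x) (lie_bracket (A i) (C k) x) * dot (C k x) (U x)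
    + bochner_form x (U x).
Proof.
have -> : Gamma1 c f f = fun y => \sum_j dir (C j) f y * dir (C j) f y.
  by apply/funext => y; exact: Gamma1E.
rewrite gen_sum_squares//; last by move=> j; smooth.
rewrite Gamma1E -sumrB.
transitivity (\sum_j (\sum_i (dir (A i) (dir (C j) f) x ^+ 2
    + 2 * (hess f x (A i x) (lie_bracket (A i) (C j) x) * dot (C j x) (U x))
    + dot (vdir (A i) (vdir (A i) (C j)) x - vdir (C j) (vdir (A i) (A i)) x) (U x)
       * dot (C j x) (U x)
    + divg (A i) x * dot (vdir (A i) (C j) x - vdir (C j) (A i) x) (U x)
      * dot (C j x) (U x)
    - dir (C j) (divg (A i)) x * dot (A i x) (U x) * dot (C j x) (U x))
  + dot (vdir h (C j) x - vdir (C j) h x) (U x) * dot (C j x) (U x))).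
  apply: eq_bigr => j _; rewrite addrAC [_ * dir (C j) f x]mulrC -mulrBr.
  rewrite gen_comm//; last by smooth.
  rewrite mulrDr mulr_sumr addrAC -big_split dirE; congr +%R; last by rewrite mulrC.
  apply: eq_bigr => i _; rewrite /=.
  change (dir (A i) [eta dir (C j) f] x) with (dir (A i) (dir (C j) f) x).
  by rewrite [in dot (lie_bracket _ _ _) _]/lie_bracket; field_atoms; ring.
rewrite big_split/= exchange_big/= sum2B !sum2D sum2Z /bochner_form.
have -> : \sum_i \sum_j dir (A i) (dir (C j) f) x ^+ 2 =
    \sum_i \sum_k (hess f x (A i x) (C k x) + dot (vdir (A i) (C k) x) (U x)) ^+ 2.
  by apply: eq_sum2 => i j; rewrite dir_dir 1?addrC//; smooth.
rewrite addrAC -!addrA; congr (_ + (_ + _)); rewrite !addrA; congr (_ - _).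
by rewrite addrAC.
Qed.
End Bochner.

Section LogDerivative.
Context (R : realType) (d k : nat).
Local Notation V := ('cV[R]_d).
Variables (c : V -> 'M[R]_(d, k)) (pi : V -> R).
Hypotheses (pi0 : forall x, 0 < pi x) (spi : smooth pi) (sc : smooth_mx c).

Lemma dir_density W x : dir W pi x = pi x * dot (W x) (gradlog pi x).
Proof.
rewrite /gradlog -dirE mulr_sumr; apply: eq_bigr => r _.
rewrite partial_ln//; last exact: smooth_derivable.
by rewrite mulrCA [pi x * _]mulrC divfK ?gt_eqF.
Qed.

Lemma divg_density W x : smooth_mx W ->
  divg (fun y => pi y *: W y) x = pi x * (divg W x + dot (W x) (gradlog pi x)).
Proof. by move=> sW; rewrite divgZ// dir_density mulrDr. Qed.

Lemma div_piE (F : V -> V) x : smooth_mx F ->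
  div_pi c pi F x =
  divg (fun y => gram c y *m F y) x + dot (gram c x *m F x) (gradlog pi x).
Proof.
move=> sF; rewrite /div_pi divg_density; last by smooth.
by rewrite mulKf ?gt_eqF.
Qed.

End LogDerivative.

Section DivPi.
Context (R : realType) (d k l : nat).
Local Notation V := ('cV[R]_d).
Variables (c : V -> 'M[R]_(d, k)) (e : V -> 'M[R]_(d, l)) (pi f : V -> R).
Hypotheses (pi0 : forall x, 0 < pi x) (spi : smooth pi).
Hypotheses (sc : smooth_mx c) (se : smooth_mx e) (sf : smooth f).
Local Notation C := (cfield c).
Local Notation E := (cfield e).
Local Notation U x := (grad f x).

Lemma dot_Gamma1_nabla W x :
  dot (W x) (Gamma1_nabla e f x)
  = \sum_i 2 * (dot (vdir W (E i) x) (U x) * dot (E i x) (U x)).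
Proof.
rewrite -mulr_sumr -sum_partial_gram//; apply: eq_bigr => r _.
by rewrite mxE.
Qed.

Lemma smooth_Gamma1_nabla : smooth_mx (Gamma1_nabla e f).
Proof. by move=> r j; under eq_fun do rewrite mxE; smooth. Qed.

(** The vector field has components quadratic in grad f, so its divergence is
    linear in the Hessian; the part free of second derivatives is one of the two
    sums of R_pi. *)
Lemma div_pi_Gamma1_nabla x :
  div_pi c pi (Gamma1_nabla e f) x
  = 2 * \sum_k \sum_i
      (dot (divg (C k) x *: vdir (C k) (E i) x
          + vdir (C k) (vdir (C k) (E i)) x
          + dot (C k x) (gradlog pi x) *: vdir (C k) (E i) x) (U x)
         * dot (E i x) (U x)
       + dot (vdir (C k) (E i) x) (U x) ^+ 2)
    + 2 * \sum_k \sum_i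
      (hess f x (C k x) (vdir (C k) (E i) x) * dot (E i x) (U x)
       + dot (vdir (C k) (E i) x) (U x) * hess f x (C k x) (E i x)).
Proof.
pose s j y := \sum_i 2 * (dot (vdir (C j) (E i) y) (U y) * dot (E i y) (U y)).
have ss j : smooth (s j) by rewrite /s; smooth.
have GE y : gram c y *m Gamma1_nabla e f y = \sum_j s j y *: C j y.
  by rewrite gramE; apply: eq_bigr => j _; rewrite dot_Gamma1_nabla.
rewrite div_piE//; last exact: smooth_Gamma1_nabla.
under [X in divg X]eq_fun do rewrite GE.
rewrite GE dot_suml divg_sum; last by move=> j _; smooth.
rewrite -big_split -mulrDr -sum2D mulr_sumr; apply: eq_bigr => j _ /=.
rewrite divgZ; [|by smooth..].
rewrite /s dir_sum; last by move=> i _; smooth.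
rewrite dotZl !mulr_suml -!big_split mulr_sumr; apply: eq_bigr => i _ /=.
rewrite dirZ; last by smooth.
rewrite dirM; [|by smooth..].
rewrite !dir_dot_grad; [|by smooth..].
rewrite !dotDl !dotZl; field_atoms; ring.
Qed.

End DivPi.

(** * The drift gamma *)

Section Drift.
Context (R : realType) (n m k : nat).
Local Notation V := ('cV[R]_(n + m)).
Variables (c : V -> 'M[R]_(n + m, k)) (pi p f : V -> R) (gam : V -> V).
Hypotheses (sc : smooth_mx c) (spi : smooth pi) (sp : smooth p) (sf : smooth f).
Hypotheses (sgam : smooth_mx gam) (pi0 : forall x, 0 < pi x).
Local Notation C := (cfield c).
Local Notation U x := (grad f x).
Local Notation h := (fun x => gram c x *m gradlog pi x).

Lemma dir_Gamma1 W x : dir W (Gamma1 c f f) x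
  = 2 * \sum_i (dot (vdir W (C i) x) (U x) * dot (C i x) (U x)
                + hess f x (W x) (C i x) * dot (C i x) (U x)).
Proof.
have -> : Gamma1 c f f = fun y => \sum_j dir (C j) f y * dir (C j) f y.
  by apply/funext => y; exact: Gamma1E.
rewrite dir_sum; last by move=> i _; smooth.
rewrite mulr_sumr; apply: eq_bigr => i _.
rewrite dirM; [|by smooth..].
by rewrite !dir_dir// -?dirE; [field_atoms; ring|smooth].
Qed.

(** The pointwise way of treating the drift: the Hessian is kept, to be absorbed
    in the square. The frame a enters R with weight beta in this form. *)
Lemma gen_dot_drift x :
  gen c pi f x * dot (U x) (gam x) - 2^-1 * dot (grad (Gamma1 c f f) x) (gam x)
  = (dot (U x) (gam x)
     * (\sum_i divg (C i) x * dot (C i x) (U x)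
        + \sum_i dot (vdir (C i) (C i) x) (U x) + dot (h x) (U x))
     - \sum_i dot (vdir gam (C i) x) (U x) * dot (C i x) (U x))
    + (dot (U x) (gam x) * \sum_i hess f x (C i x) (C i x)
       - \sum_i hess f x (gam x) (C i x) * dot (C i x) (U x)).
Proof.
have sq : smooth (fun x => ln (pi x)) by exact: smooth_ln.
rewrite [dot (grad (Gamma1 c f f) x) _]dotC -(dirE gam (Gamma1 c f f) x).
rewrite dir_Gamma1 mulKf ?pnatr_eq0//.
rewrite genE// (dirE h) big_split/=.
have -> : \sum_i dir (C i) (dir (C i) f) x = \sum_i dot (vdir (C i) (C i) x) (U x)
    + \sum_i hess f x (C i x) (C i x).
  rewrite -big_split; apply: eq_bigr => i _; rewrite dir_dir//; smooth.
under [in LHS]eq_bigr do rewrite dirE.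
rewrite big_split/=.
move: (\sum_i _) (\sum_i _) (\sum_i _) (\sum_i _) (\sum_i _) => s1 s2 s3 s4 s5.
field_atoms; ring.
Qed.

Hypothesis p_log : forall W x,
  dir W p x = p x * (dot (W x) (gradlog pi x) + dot (W x) (U x)).
Hypothesis gam_free : forall x, divg gam x + dot (gam x) (gradlog pi x) = 0.

Lemma dot_nabla u x : dot (nabla_mx gam x *m U x) u
  = dot (vdir (fun=> u) gam x) (U x).
Proof.
rewrite /dot; under eq_bigr do rewrite mxE mulr_suml.
rewrite exchange_big; apply: eq_bigr => s _ /=; rewrite vdirE mulr_suml.
by apply: eq_bigr => r _; rewrite !mxE; ring.
Qed.

(** The integrated way of treating the drift: up to two divergences no second
    derivative of f is left. The Hessian at (gam, c c^T grad f), which appears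
    when s = grad f . gam is differentiated along c c^T grad f, is half of the
    derivative of Gamma1 along gam up to derivatives of c; the terms p s Gamma1
    cancel because p gam has divergence p s. *)
Lemma drift_by_parts x :
  (gen c pi f x * dot (U x) (gam x) - 2^-1 * dot (grad (Gamma1 c f f) x) (gam x))
    * p x
  = R_gamma gam c x (U x) * p x
    + (divg (fun y => (p y * dot (U y) (gam y)) *: (gram c y *m U y)) x
       - divg (fun y => (p y * Gamma1 c f f y) *: gam y) x).
Proof.
have sG : smooth_mx (fun y => gram c y *m U y) by smooth.
have sG1 := smooth_Gamma1 sc sf sf.
rewrite !divgZ; [|by smooth..].
rewrite !dirM; [|by smooth..].
rewrite !p_log.
have -> : dot (gram c x *m U x) (U x) = Gamma1 c f f x.
  rewrite gramE dot_suml Gamma1E; apply: eq_bigr => i _.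
  by rewrite dotZl dirE.
have -> : dir (fun y => gram c y *m U y) (fun y => dot (U y) (gam y)) x =
    dot (nabla_mx gam x *m U x) (gram c x *m U x)
    + hess f x (gam x) (gram c x *m U x).
  under [X in dir _ X]eq_fun do rewrite dotC.
  by rewrite dir_dot_grad// dot_nabla hessC.
have genG : gen c pi f x = divg (fun y => gram c y *m U y) x
    + dot (gram c x *m U x) (gradlog pi x).
  rewrite /gen; congr +%R; rewrite !gramE !dot_suml; apply: eq_bigr => i _.
  by rewrite !dotZl mulrC.
have -> : hess f x (gam x) (gram c x *m U x)
    = \sum_i hess f x (gam x) (C i x) * dot (C i x) (U x).
  by rewrite gramE hess_sumr; apply: eq_bigr => i _; rewrite hessZr mulrC.
rewrite genG [dot (grad (Gamma1 c f f) x) _]dotC -(dirE gam (Gamma1 c f f) x).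
rewrite dir_Gamma1 /R_gamma sum_partial_gram//.
rewrite !mulKf ?pnatr_eq0// [dot (gam x) (U x)]dotC.
have -> : divg gam x = - dot (gam x) (gradlog pi x).
  by apply/eqP; rewrite -addr_eq0 gam_free.
rewrite big_split/=.
move: (\sum_i _) (\sum_i _) (Gamma1 _ _ _ _) (p x) => s1 s2 s3 s4.
field_atoms; ring.
Qed.

End Drift.

Section Stationary.
Context (R : realType) (n m : nat).
Local Notation V := ('cV[R]_(n + m)).
Variables (b : V -> V) (a : V -> 'M[R]_(n + m, n)) (pi : V -> R).
Hypotheses (sa : smooth_mx a) (sb : smooth_mx b) (spi : smooth pi).
Hypotheses (pi0 : forall x, 0 < pi x) (inv : invariant_density b a pi).

Lemma smooth_gamma_field : smooth_mx (gamma_field b a pi).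
Proof.
have sq := smooth_ln pi0 spi; have sg := smooth_gram sa.
rewrite /gamma_field /gradlog; apply: smooth_mxD; first by smooth.
move=> i j; under eq_fun do rewrite mxE.
by apply: smooth_sum => l _; apply: smooth_partial; exact: sg.
Qed.

(** The stationary Fokker-Planck equation says that pi gam is divergence free,
    because pi gam_i = sum_j d_j ((a a^T)_ij pi) - pi b_i. *)
Lemma gamma_field_stationary x :
  divg (gamma_field b a pi) x + dot (gamma_field b a pi x) (gradlog pi x) = 0.
Proof.
have sgam := smooth_gamma_field; have sg := smooth_gram sa.
apply: (mulfI (lt0r_neq0 (pi0 x))); rewrite mulr0 -divg_density//.
have [_ _ /(_ x) <-] := inv.
have sbi i : smooth (fun y => pi y * b y i ord0) by exact: smoothM.
have sgi i j : smooth (fun y => gram a y i j * pi y) by exact: smoothM.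
rewrite addrC -sumrB; apply: eq_bigr => i _.
have -> : (fun y => (pi y *: gamma_field b a pi y) i ord0) =
    fun y => \sum_j partial j (fun z => gram a z i j * pi z) y
             + -1 * (pi y *: b y) i ord0.
  apply/funext => y; rewrite mxE /gamma_field mxE [(_ - b y) i ord0]mxE.
  rewrite [(- b y) i ord0]mxE [(_ *m _) i ord0]mxE [(\col_ _ _) i ord0]mxE.
  rewrite [(pi y *: b y) i ord0]mxE.
  under [in RHS]eq_bigr do rewrite partialM//.
  have gl j : gradlog pi y j ord0 = partial j pi y / pi y.
    by rewrite mxE partial_ln//; exact: smooth_derivable.
  under [in LHS]eq_bigr do rewrite gl.
  rewrite big_split/= !mulrDr mulr_sumr mulN1r mulrN addrAC mulr_sumr.
  congr (_ + _ - _); apply: eq_bigr => j _.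
  by rewrite mulrCA [pi y * _]mulrC divfK ?gt_eqF.
rewrite partialD; last 2 first.
- by apply: smooth_sum => j _; smooth.
- by under eq_fun do rewrite mxE; smooth.
rewrite partialM; [|exact: smooth_cst|by under eq_fun do rewrite mxE; exact: sbi].
rewrite partial_cst mulr0 addr0 mulN1r; congr (_ - _).
by rewrite partial_sum// => j _; smooth.
Qed.

End Stationary.

(** * Null perturbations of integrals *)

Section BorelRd.
Context (R : realType) (d : nat).
Local Notation V := ('cV[R]_d).

(** The product sigma-algebra is generated by boxes, and an open set is the
    countable union of the boxes with rational corners that it contains. *)
Lemma measurable_open_col (A : set V) :
  open A -> measurable (@col_of_tuple R d @^-1` A).
Proof.
move=> oA.
(* Pairs of rational corners, indexed by a countable type. *)
pose box (q : {ffun 'I_d -> rat * rat}) : set (d.-tuple (measurableTypeR R)) :=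
  [set t | forall i, tnth t i \in `]ratr (q i).1, ratr (q i).2[].
pose F q := if `[< box q `<=` @col_of_tuple R d @^-1` A >] then box q else set0.
have mbox q : measurable (box q).
  rewrite (_ : box q = \bigcap_(i in [set: 'I_d])
      ((@tnth _ (measurableTypeR R))^~ i @^-1` `]ratr (q i).1, ratr (q i).2[%classic)).
    apply: fin_bigcap_measurable => // i _.
    rewrite -[X in measurable X]setTI.
    have := @measurable_tnth _ (measurableTypeR R) d i measurableT.
    by apply; exact: measurable_itv.
  by apply/seteqP; split => [t qt i _|t qt i]; [exact: qt|exact: (qt i)].
have -> : @col_of_tuple R d @^-1` A = \bigcup_q F q.
  apply/seteqP; split => [t At|t [q _]]; last first.
    by rewrite /F; case: asboolP => // qA; exact: qA.
  have /nbhs_ballP[e /= e0 eA] : nbhs (col_of_tuple t) A by exact: open_nbhs_nbhs.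
  have /choice[q qP] : forall i : 'I_d, exists q : rat * rat,
      [/\ tnth t i - e < ratr q.1, ratr q.1 < tnth t i,
          tnth t i < ratr q.2 & ratr q.2 < tnth t i + e].
    move=> i.
    have /rat_in_itvoo[q1] : tnth t i - e < tnth t i by rewrite ltrBlDr ltrDl.
    have /rat_in_itvoo[q2] : tnth t i < tnth t i + e by rewrite ltrDl.
    by rewrite !in_itv/= => /andP[? ?] /andP[? ?]; exists (q1, q2).
  exists [ffun i => q i] => //; rewrite /F; case: asboolP => [_|].
    by move=> i; rewrite ffunE in_itv/=; have [_ -> ->] := qP i.
  case=> s /= qs; apply: eA; split => // i j; rewrite !mxE.
  have := qs i; rewrite ffunE in_itv/= => /andP[s1 s2].
  have [q1 _ _ q2] := qP i; rewrite -ball_normE /= ltr_norml.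
  by apply/andP; split; lra.
apply: countable_bigcupT_measurable => //.
by move=> q; rewrite /F; case: ifP.
Qed.

Lemma measurable_continuous_col (g : V -> R) : continuous g ->
  measurable_fun [set: d.-tuple (measurableTypeR R)]
    (fun t => g (col_of_tuple t)).
Proof.
move=> /continuousP cg mT; apply: (measurability _ (RGenOInfty.measurableE R)) => //.
move=> _ [_ [x ->] <-]; rewrite setTI.
apply: (@measurable_open_col (g @^-1` `]x, +oo[%classic)).
by apply: cg; exact: rray_open.
Qed.

End BorelRd.

Section NullPerturbation.
Local Open Scope ereal_scope.
Context d (T : measurableType d) (R : realType).
Variable mu : {measure set T -> \bar R}.
Implicit Types u v : T -> R.

Let pos u := \int[mu]_x (Num.max (u x) 0)%:E.

Lemma integral_posneg u : \int[mu]_x (u x)%:E = pos u - pos (fun x => - u x)%R.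
Proof.
rewrite integralE; congr (_ - _); apply: eq_integral => x _.
  by rewrite funeposE EFin_max.
by rewrite funenegE EFin_max.
Qed.

Let measurable_pos u : measurable_fun setT u ->
  measurable_fun setT (fun x => (Num.max (u x) 0)%:E).
Proof.
by move=> mu0; apply/measurable_EFinP; exact: measurable_maxr.
Qed.

Lemma pos_perturbation u v : measurable_fun setT u -> measurable_fun setT v ->
  pos u <= pos (u \+ v)%R + \int[mu]_x `|(v x)%:E|.
Proof.
move=> mu0 mv; rewrite -ge0_integralD//; last 3 first.
- by move=> x _; rewrite lee_fin le_max lexx orbT.
- by apply: measurable_pos; exact: measurable_funD.
- by apply: measurableT_comp => //; exact/measurable_EFinP.
apply: ge0_le_integral => //.
- by move=> x _; rewrite lee_fin le_max lexx orbT.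
- exact: measurable_pos.
- apply: emeasurable_funD; first by apply: measurable_pos; exact: measurable_funD.
  by apply: measurableT_comp => //; exact/measurable_EFinP.
move=> x _; rewrite -EFinD lee_fin ge_max; apply/andP; split; last first.
  by rewrite addr_ge0// le_max lexx orbT.
rewrite -lerBlDr (@le_trans _ _ (u x + v x)%R)//; last by rewrite le_max lexx.
by rewrite lerD2l lerNl ler_normr lexx orbT.
Qed.

(** Neither side needs to be integrable: perturbing by an integrable v changes
    the positive and the negative parts by a finite amount, so each of them stays
    finite or stays infinite, and the conventions for infinite integrals give the
    same value. *)
Lemma integral_null_perturbation u v : measurable_fun setT u ->
  mu.-integrable setT (EFin \o v) -> \int[mu]_x (v x)%:E = 0 ->
  \int[mu]_x (u x + v x)%:E = \int[mu]_x (u x)%:E.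
Proof.
move=> mu0 iv v0; have mv : measurable_fun setT v.
  by apply/measurable_EFinP; exact: measurable_int iv.
have [iu|niu] := pselect (mu.-integrable setT (EFin \o u)).
  under eq_integral do rewrite EFinD.
  by rewrite integralD// v0 adde0.
have voo : \int[mu]_x `|(v x)%:E| < +oo by have /integrableP[] := iv.
have v'oo : \int[mu]_x `|(- v x)%:E| < +oo.
  by under eq_integral do rewrite EFinN abseN.
have neg_oo (w w' : T -> R) : measurable_fun setT w -> measurable_fun setT w' ->
    \int[mu]_x `|(w' x)%:E| < +oo -> pos w = +oo -> pos (w \+ w')%R = +oo.
  move=> mw mw' w'oo woo; have := pos_perturbation mw mw'; rewrite woo.
  rewrite leye_eq => /eqP; case: (pos _) => [r|//|]; move: w'oo.
    by case: (\int[mu]_x _).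
  by case: (\int[mu]_x _).
have mNu : measurable_fun setT (fun x => - u x)%R by exact: measurableT_comp.
have mNv : measurable_fun setT (fun x => - v x)%R by exact: measurableT_comp.
have muv : measurable_fun setT (u \+ v)%R by exact: measurable_funD.
have Nuv : (fun x => - (u x + v x))%R = ((fun x => - u x) \+ (fun x => - v x))%R.
  by apply/funext => x; rewrite opprD.
rewrite !integral_posneg Nuv.
have [noo|nfin] := eqVneq (pos (fun x => - u x)%R) +oo.
  by rewrite noo (neg_oo _ _ mNu mNv v'oo noo) !addeNy.
have [poo|pfin] := eqVneq (pos u) +oo.
  have oppN (r : \bar R) : r != +oo -> - r != -oo by case: r.
  rewrite poo (neg_oo _ _ mu0 mv voo poo) !addye//; apply: oppN => //.
  apply: contra nfin => /eqP E; apply/eqP.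
  rewrite (_ : (fun x => - u x)%R = ((fun x => - u x) \+ (fun x => - v x)) \+ v)%R.
    by apply: neg_oo => //; exact: measurable_funD.
  by apply/funext => x /=; rewrite subrK.
exfalso; apply: niu; apply/integrableP; split; first exact/measurable_EFinP.
rewrite (_ : (fun x => _) =
  (fun x => (Num.max (u x) 0)%:E + (Num.max (- u x)%R 0)%:E)).
  rewrite ge0_integralD//=.
  - by rewrite lte_add_pinfty// ltey.
  - by move=> x _; rewrite lee_fin le_max lexx orbT.
  - exact: measurable_pos.
  - by move=> x _; rewrite lee_fin le_max lexx orbT.
  - exact: measurable_pos.
apply/funext => x /=; rewrite -EFinD; congr EFin.
have [ux|ux] := lerP 0%R (u x).
  by rewrite ger0_norm// max_r ?oppr_le0// addr0.
by rewrite ltr0_norm// max_l ?oppr_ge0 ?ltW// add0r.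
Qed.

End NullPerturbation.

(** * Completing the square in the frame (a, z) *)

Ltac sum_atoms :=
  repeat match goal with
  | |- context [@bigop ?R ?I ?r ?b ?F] => generalize (@bigop R I r b F) => ?
  end.

Section LinearCombinations.
Context (R : realType) (k : nat).
Implicit Types q t : 'I_k -> R.

Lemma sum_mul5 q t1 t2 t3 t4 t5 :
  \sum_l q l * (t1 l + t2 l - t3 l - t4 l + t5 l)
  = \sum_l q l * t1 l + \sum_l q l * t2 l - \sum_l q l * t3 l
    - \sum_l q l * t4 l + \sum_l q l * t5 l.
Proof.
under eq_bigr do rewrite mulrDr !mulrBr mulrDr.
by rewrite big_split/= !sumrB big_split.
Qed.

Lemma sum_mul7 q t1 t2 t3 t4 t5 t6 t7 :
  \sum_l q l * (t1 l + t2 l + t3 l + t4 l - t5 l - t6 l - t7 l)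
  = \sum_l q l * t1 l + \sum_l q l * t2 l + \sum_l q l * t3 l
    + \sum_l q l * t4 l - \sum_l q l * t5 l - \sum_l q l * t6 l
    - \sum_l q l * t7 l.
Proof.
under eq_bigr do rewrite !mulrBr !mulrDr.
by rewrite !sumrB !big_split.
Qed.

(** Completing the square: both sides differ from the sum of the q_l^2 by a term
    linear in q. *)
Lemma sum_square_shift q t1 t2 :
  \sum_l (q l + t1 l) ^+ 2 - \sum_l t1 l ^+ 2 + \sum_l t2 l ^+ 2
  = \sum_l (q l + t2 l) ^+ 2 + 2 * \sum_l q l * (t1 l - t2 l).
Proof.
rewrite -sumrB -big_split mulr_sumr -big_split; apply: eq_bigr => l _ /=; ring.
Qed.
End LinearCombinations.

Section Frame.
Context (R : realType) (n m : nat).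
Local Notation V := ('cV[R]_(n + m)).
Variables (a : V -> 'M[R]_(n + m, n)) (z : V -> 'M[R]_(n + m, m)).
Local Notation A := (cfield a).
Local Notation Z := (cfield z).

(** The columns of a and z form a basis of R^(n+m), so coefficients in this
    frame are unique. *)
Lemma frame_free x (c e : 'I_(n + m) -> R) :
  \rank (gram a x + gram z x) = (n + m)%N ->
  \sum_(l < n) c (lshift m l) *: A l x + \sum_(l < m) c (rshift n l) *: Z l x
  = \sum_(l < n) e (lshift m l) *: A l x + \sum_(l < m) e (rshift n l) *: Z l x ->
  c =1 e.
Proof.
move=> rk; pose M := row_mx (a x) (z x).
have uM : M \in unitmx.
  rewrite -row_full_unit /row_full eqn_leq rank_leq_col/=.
  (* Inside \rank the sum denotes the sum of row spaces, not of matrices. *)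
  have : (gram a x + gram z x <= M^T)%MS.
    by rewrite /M tr_row_mx -addsmxE addsmxS// submxMl.
  by move/mxrankS; rewrite rk mxrank_tr.
have combE (g : 'I_(n + m) -> R) :
    \sum_(l < n) g (lshift m l) *: A l x + \sum_(l < m) g (rshift n l) *: Z l x
    = M *m (\col_l g l).
  apply/colP => r; rewrite !mxE big_split_ord/= !summxE; congr +%R;
    apply: eq_bigr => l _; rewrite !mxE mulrC; congr (_ * _).
    by rewrite (unsplitK (inl _)).
  by rewrite (unsplitK (inr _)).
rewrite !combE => /(congr1 (mulmx (invmx M))); rewrite !mulKmx// => ce l.
by move/colP : ce => /(_ l); rewrite !mxE.
Qed.

Lemma frame_sum (F : V -> V) (k : nat) (e : V -> 'M[R]_(n + m, k)) i
    (c : 'I_(n + m) -> 'I_(n + m) -> V -> R) x :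
  (forall r, partial_mx r F x = frame_comb a z (c r) x) ->
  vdir (cfield e i) F x
  = \sum_(l < n) (\sum_r e x r i * c r (lshift m l) x) *: A l x
    + \sum_(l < m) (\sum_r e x r i * c r (rshift n l) x) *: Z l x.
Proof.
move=> cF; rewrite /vdir; under eq_bigr do rewrite cF mxE.
under eq_bigr do rewrite scalerDr !scaler_sumr.
rewrite big_split/=; congr +%R; rewrite exchange_big/=; apply: eq_bigr => l _;
  by rewrite scaler_suml; apply: eq_bigr => r _; rewrite scalerA.
Qed.

End Frame.

Section Pointwise.
Context (R : realType) (n m : nat).
Local Notation V := ('cV[R]_(n + m)).
Variables (a : V -> 'M[R]_(n + m, n)) (z : V -> 'M[R]_(n + m, m)).
Variables (pi f : V -> R) (gam : V -> V).
Local Notation A := (cfield a).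
Local Notation Z := (cfield z).
Local Notation U x := (grad f x).
Variables (lam : 'I_(n + m) -> 'I_n -> 'I_(n + m) -> V -> R).
Variables (om : 'I_(n + m) -> 'I_m -> 'I_(n + m) -> V -> R).
Variables (al : 'I_(n + m) -> V -> R) (beta : R).
Hypotheses (sa : smooth_mx a) (sz : smooth_mx z) (sf : smooth f).
Hypotheses (spi : smooth pi) (pi0 : forall x, 0 < pi x).
Hypothesis az : structure_condition a z.
Hypothesis coefE : frame_coefficients a z gam lam om al.

Local Notation Q x i k := (hess f x (A i x) (A k x)).
Local Notation P x i k := (hess f x (A i x) (Z k x)).

Lemma QXE x i k : QX a f x i k = Q x i k.
Proof.
rewrite mxE; apply: eq_bigr => r _; apply: eq_bigr => s _.
by rewrite !mxE.
Qed.

Lemma PXE x i k : PX a z f x i k = P x i k.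
Proof.
rewrite mxE; apply: eq_bigr => r _; apply: eq_bigr => s _.
by rewrite !mxE.
Qed.

(** By (S) the field lies in the span of the A_l, and uniqueness of the
    coefficients removes the components of its lambda-expansion along the z_l. *)
Lemma vdir_ZA x k i :
  vdir (Z k) (A i) x = \sum_l (\sum_r z x r k * lam r i (lshift m l) x) *: A l x.
Proof.
have [lamE _ _] := coefE; have [_ rk span] := az.
have E := frame_sum z k (fun r => lamE r i x).
have [c cE] := span i k x.
(* The coefficients given by (S), extended by 0 along the z_l. *)
pose c' (j : 'I_(n + m)) := if fintype.split j is inl l then c l else 0.
have c'l l : c' (lshift m l) = c l by rewrite /c' (unsplitK (inl _)).
have c'r l : c' (rshift n l) = 0 by rewrite /c' (unsplitK (inr _)).
have := @frame_free _ _ _ a z x (fun j => \sum_r z x r k * lam r i j x) c' (rk x).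
rewrite -E cE.
have -> : \sum_(l < m) c' (rshift n l) *: Z l x = 0.
  by rewrite big1// => l _; rewrite c'r scale0r.
under [in X in (_ = X + _ -> _)]eq_bigr do rewrite c'l.
rewrite addr0 => /(_ erefl) H; apply: eq_bigr => l _.
by rewrite H c'l.
Qed.

(** The Hessian is linear in its second argument: contracting QX and PX with the
    frame coefficients of v_j gives back the Hessian at (A_i, v_j). The coefficients
    of Lambda1 and Lambda2 are designed for this. *)
Lemma hess_frame x i (k : nat) (c : 'I_k -> 'I_(n + m) -> R) (s : 'I_k -> R)
    (v : 'I_k -> V) :
  (forall j, v j = \sum_(l < n) c j (lshift m l) *: A l x
                 + \sum_(l < m) c j (rshift n l) *: Z l x) ->
  \sum_l Q x i l * (\sum_j c j (lshift m l) * s j)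
  + \sum_l P x i l * (\sum_j c j (rshift n l) * s j)
  = \sum_j hess f x (A i x) (v j) * s j.
Proof.
move=> vE.
under eq_bigr do rewrite mulr_sumr.
under [X in _ + X]eq_bigr do rewrite mulr_sumr.
rewrite exchange_big [X in _ + X]exchange_big -big_split; apply: eq_bigr => j _ /=.
rewrite vE hessDr !hess_sumr mulrDl !mulr_suml; congr +%R; apply: eq_bigr => l _;
  rewrite hessZr; field_atoms; ring.
Qed.

Lemma cross_row x i :
  \sum_l Q x i l * (Lambda1 a z gam lam om al beta x (U x) i l - D_mx a x (U x) i l)
  + \sum_l P x i l * (Lambda2 a z lam om al beta x (U x) i l - E_mx a z x (U x) i l)
  = \sum_k hess f x (A i x) (lie_bracket (A i) (A k) x) * dot (A k x) (U x)
    + \sum_k hess f x (A i x) (lie_bracket (A i) (Z k) x) * dot (Z k x) (U x)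
    + \sum_l P x i l * (\sum_k (\sum_r z x r l * lam r k (lshift m i) x)
                               * dot (A k x) (U x))
    + \sum_l P x i l * dot (vdir (Z l) (A i) x) (U x)
    - \sum_k hess f x (A i x) (vdir (A i) (Z k) x) * dot (Z k x) (U x)
    - \sum_l P x i l * dot (vdir (A i) (Z l) x) (U x)
    - beta / 2 * hess f x (A i x) (gam x) * dot (A i x) (U x)
    + beta / 2 * dot (U x) (gam x) * Q x i i.
Proof.
have [lamE omE galE] := coefE.
under eq_bigr do rewrite mxE addrK.
under [X in _ + X]eq_bigr do rewrite mxE addrK.
rewrite sum_mul5 sum_mul7.
rewrite -(@hess_frame x i n
   (fun k l => \sum_r (a x r i * lam r k l x - a x r k * lam r i l x))
   (fun k => dot (A k x) (U x))); last first.
  move=> k; rewrite /lie_bracket (frame_sum a i (fun r => lamE r k x)).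
  rewrite (frame_sum a k (fun r => lamE r i x)) opprD addrACA -!sumrB.
  congr +%R; apply: eq_bigr => l _; by rewrite sumrB scalerBl.
rewrite -(@hess_frame x i m
   (fun k l => \sum_r (a x r i * om r k l x - z x r k * lam r i l x))
   (fun k => dot (Z k x) (U x))); last first.
  move=> k; rewrite /lie_bracket (frame_sum a i (fun r => omE r k x)).
  rewrite (frame_sum z k (fun r => lamE r i x)) opprD addrACA -!sumrB.
  congr +%R; apply: eq_bigr => l _; by rewrite sumrB scalerBl.
rewrite -(@hess_frame x i m (fun k l => \sum_r a x r i * om r k l x)
   (fun k => dot (Z k x) (U x)) (fun k => vdir (A i) (Z k) x)); last first.
  by move=> k; exact: (frame_sum a i (fun r => omE r k x)).
have -> : beta / 2 * hess f x (A i x) (gam x) * dot (A i x) (U x)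
  = \sum_l Q x i l * (beta / 2 * al (lshift m l) x * dot (A i x) (U x))
    + \sum_l P x i l * (beta / 2 * al (rshift n l) x * dot (A i x) (U x)).
  move: (dot (A i x) (U x)) => s.
  rewrite galE hessDr !hess_sumr mulrDr mulrDl !mulr_sumr !mulr_suml.
  by congr +%R; apply: eq_bigr => l _; rewrite hessZr; field_atoms; ring.
have -> : beta / 2 * dot (U x) (gam x) * Q x i i
   = \sum_l Q x i l * (beta / 2 * dot (U x) (gam x) * (i == l)%:R).
  rewrite (bigD1 i)//= eqxx mulr1 big1 ?addr0 1?mulrC// => l.
  by rewrite eq_sym => /negbTE ->; rewrite mulr0 mulr0.
sum_atoms; ring.
Qed.

(** The only second-order terms that do not contain a field A_i are the Hessians
    at (Z_l, Z_l a_k). As Z_l a_k is a combination of the A_i, they too become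
    entries of PX; this is where the structure condition enters. *)
Lemma cross_span x :
  \sum_i \sum_l P x i l * (\sum_k (\sum_r z x r l * lam r k (lshift m i) x)
                               * dot (A k x) (U x))
  = \sum_l \sum_k hess f x (Z l x) (vdir (Z l) (A k) x) * dot (A k x) (U x).
Proof.
rewrite exchange_big; apply: eq_bigr => l _ /=.
under eq_bigr do rewrite mulr_sumr.
rewrite exchange_big; apply: eq_bigr => k _ /=.
rewrite vdir_ZA hess_sumr mulr_suml; apply: eq_bigr => i _.
rewrite hessZr [hess f x (Z l x) _]hessC// mulrA; congr (_ * _); exact: mulrC.
Qed.

Lemma square_completion (k : nat) (q l e : 'M[R]_(n, k)) :
  sqnorm (q + l) - sqnorm l + sqnorm e
  = \sum_i \sum_j (q i j + e i j) ^+ 2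
    + 2 * \sum_i \sum_j q i j * (l i j - e i j).
Proof.
rewrite /sqnorm -sumrB -big_split mulr_sumr -big_split; apply: eq_bigr => i _ /=.
under eq_bigr do rewrite mxE.
exact: sum_square_shift.
Qed.

Lemma R_pi_div_pi x :
  R_pi a z pi x (U x)
  + 2 * (\sum_k \sum_i hess f x (Z k x) (vdir (Z k) (A i) x) * dot (A i x) (U x)
         + \sum_k \sum_i dot (vdir (Z k) (A i) x) (U x) * hess f x (Z k x) (A i x))
  - 2 * (\sum_i \sum_k hess f x (A i x) (vdir (A i) (Z k) x) * dot (Z k x) (U x)
         + \sum_i \sum_k dot (vdir (A i) (Z k) x) (U x) * hess f x (A i x) (Z k x))
  = div_pi z pi (Gamma1_nabla a f) x - div_pi a pi (Gamma1_nabla z f) x.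
Proof.
rewrite !div_pi_Gamma1_nabla// /R_pi -!sum2D.
rewrite [X in _ - 2 * X + _ - _]exchange_big.
by rewrite opprD -!addrA; congr +%R; rewrite addrCA.
Qed.

(** The cross terms of the completed square are exactly the Hessian terms
    produced by the two Bochner identities, by the two weighted divergences and,
    with weight beta, by the drift along a. *)
Lemma cross_total x :
  \sum_i \sum_j QX a f x i j
      * (Lambda1 a z gam lam om al beta x (U x) i j - D_mx a x (U x) i j)
  + \sum_i \sum_j PX a z f x i j
      * (Lambda2 a z lam om al beta x (U x) i j - E_mx a z x (U x) i j)
  = \sum_i \sum_k hess f x (A i x) (lie_bracket (A i) (A k) x) * dot (A k x) (U x)
    + \sum_i \sum_k hess f x (A i x) (lie_bracket (A i) (Z k) x) * dot (Z k x) (U x)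
    + \sum_k \sum_i hess f x (Z k x) (vdir (Z k) (A i) x) * dot (A i x) (U x)
    + \sum_k \sum_i dot (vdir (Z k) (A i) x) (U x) * hess f x (Z k x) (A i x)
    - \sum_i \sum_k hess f x (A i x) (vdir (A i) (Z k) x) * dot (Z k x) (U x)
    - \sum_i \sum_k dot (vdir (A i) (Z k) x) (U x) * hess f x (A i x) (Z k x)
    - beta / 2 * \sum_i hess f x (gam x) (A i x) * dot (A i x) (U x)
    + beta / 2 * dot (U x) (gam x) * \sum_i Q x i i.
Proof.
under eq_sum2 do rewrite QXE.
under [X in _ + X]eq_sum2 do rewrite PXE.
rewrite -big_split/=; under eq_bigr do rewrite cross_row.
rewrite big_split/= !sumrB !big_split/= cross_span.
congr (_ + _ + _ + _ - _ - _ - _ + _).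
- rewrite exchange_big; apply: eq_sum2 => l i /=.
  by rewrite [hess f x (Z l x) _]hessC// mulrC.
- by apply: eq_sum2 => i l; rewrite mulrC.
- by rewrite mulr_sumr; apply: eq_bigr => i _; rewrite hessC// mulrA.
- by rewrite [RHS]mulr_sumr.
Qed.

(** The pointwise identity. The term with factor beta is the second-order part of
    the drift along a, as in [gen_dot_drift]. *)
Lemma Gamma2_completed_square x :
  Gamma2 a pi f x + Gamma2_z_pi a z pi f x
  + beta * (dot (U x) (gam x) * \sum_i Q x i i
            - \sum_i hess f x (gam x) (A i x) * dot (A i x) (U x))
  = Hess_beta_sqnorm a z gam lam om al beta f x
    + ((R_a a pi x (U x) + R_z a z pi x (U x) + R_pi a z pi x (U x))
       - sqnorm (Lambda1 a z gam lam om al beta x (U x))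
       - sqnorm (Lambda2 a z lam om al beta x (U x))
       + sqnorm (D_mx a x (U x)) + sqnorm (E_mx a z x (U x))).
Proof.
have sq := smooth_ln pi0 spi.
have := bochner sa sa sq sf x; have := bochner sa sz sq sf x.
have := square_completion (QX a f x) (Lambda1 a z gam lam om al beta x (U x))
  (D_mx a x (U x)).
have := square_completion (PX a z f x) (Lambda2 a z lam om al beta x (U x))
  (E_mx a z x (U x)).
have -> : \sum_i \sum_j (QX a f x i j + D_mx a x (U x) i j) ^+ 2 =
    \sum_i \sum_k (hess f x (A i x) (A k x) + dot (vdir (A i) (A k) x) (U x)) ^+ 2.
  by apply: eq_sum2 => i j; rewrite QXE mxE.
have -> : \sum_i \sum_j (PX a z f x i j + E_mx a z x (U x) i j) ^+ 2 =
    \sum_i \sum_k (hess f x (A i x) (Z k x) + dot (vdir (A i) (Z k) x) (U x)) ^+ 2.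
  by apply: eq_sum2 => i j; rewrite PXE mxE.
have := R_pi_div_pi x.
have := cross_total x.
rewrite /Hess_beta_sqnorm /Gamma2 /Gamma2_z_pi.
rewrite -[bochner_form a a pi x _]/(R_a a pi x (U x)).
rewrite -[bochner_form a z pi x _]/(R_z a z pi x (U x)).
sum_atoms.
repeat match goal with |- context [@sqnorm ?R ?p ?q ?M] =>
  generalize (@sqnorm R p q M) => ? end.
move: (gen _ _ (Gamma1 a f f) x) (gen _ _ (Gamma1 z f f) x) (Gamma1 _ _ _ x)
  (Gamma1 _ _ _ x) (R_a _ _ _ _) (R_z _ _ _ _ _) (R_pi _ _ _ _ _)
  (div_pi _ _ _ _) (div_pi _ _ _ _).
field_atoms.
move=> *; lra.
Qed.

End Pointwise.

(** * The integrated identity *)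

Section NullIntegral.
Context (R : realType) (d : nat).
Local Notation V := ('cV[R]_d).
Implicit Types g k : V -> R.

Definition null_integral g := integrable_Rd g /\ integral_Rd g = 0%E.

Lemma null_integral_lin (s t : R) g k : null_integral g -> null_integral k ->
  null_integral (fun x => s * g x + t * k x).
Proof.
move=> [ig g0] [ik k0].
have isg : (@lebesgue_tuple R d).-integrable setT
    (fun y => s%:E * (g (col_of_tuple y))%:E)%E by exact: integrableZl.
have itk : (@lebesgue_tuple R d).-integrable setT
    (fun y => t%:E * (k (col_of_tuple y))%:E)%E by exact: integrableZl.
have E : (fun y => (s * g (col_of_tuple y) + t * k (col_of_tuple y))%:E) =
    (fun y => s%:E * (g (col_of_tuple y))%:E + t%:E * (k (col_of_tuple y))%:E)%E
    :> (d.-tuple (measurableTypeR R) -> \bar R).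
  by apply/funext => y; rewrite EFinD !EFinM.
split; first by rewrite /integrable_Rd E; exact: integrableD.
rewrite /integral_Rd E integralD// !integralZl//.
by move: g0 k0; rewrite /integral_Rd => -> ->; rewrite !mule0 adde0.
Qed.

Lemma integral_Rd_null g k : continuous g -> null_integral k ->
  integral_Rd (fun x => g x + k x) = integral_Rd g.
Proof.
move=> cg [ik k0].
exact: (integral_null_perturbation (measurable_continuous_col cg) ik k0).
Qed.

End NullIntegral.

Theorem theorem10 (R : realType) (n m : nat) (n_ge1 : (1 <= n)%N)
  (b : 'cV[R]_(n + m) -> 'cV[R]_(n + m))
  (a : 'cV[R]_(n + m) -> 'M[R]_(n + m, n))
  (b_smooth : smooth_mx b) (b_lip : lipschitz b)
  (a_smooth : smooth_mx a) (a_lip : lipschitz a)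
  (a_rank : forall x, \rank (a x) = n)
  (ba_hormander : weak_hormander b a)
  (pi : 'cV[R]_(n + m) -> R)
  (pi_invariant : invariant_density b a pi)
  (pi_unique : forall rho, invariant_density b a rho -> rho = pi)
  (pi_gt0 : forall x, 0 < pi x)
  (gam : 'cV[R]_(n + m) -> 'cV[R]_(n + m))
  (gamE : gam = gamma_field b a pi)
  (z : 'cV[R]_(n + m) -> 'M[R]_(n + m, m))
  (az_structure : structure_condition a z)
  (lam : 'I_(n + m) -> 'I_n -> 'I_(n + m) -> 'cV[R]_(n + m) -> R)
  (om : 'I_(n + m) -> 'I_m -> 'I_(n + m) -> 'cV[R]_(n + m) -> R)
  (al : 'I_(n + m) -> 'cV[R]_(n + m) -> R)
  (coefE : frame_coefficients a z gam lam om al)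
  (p : 'cV[R]_(n + m) -> R)
  (p_smooth : smooth p) (p_gt0 : forall x, 0 < p x) (p_density : prob_density p)
  (f : 'cV[R]_(n + m) -> R)
  (fE : f = fun x => ln (p x / pi x)) (f_smooth : smooth f)
  (no_boundary : no_boundary_terms a z gam p f)
  (beta : R) :
  integral_Rd (fun x =>
    (Gamma2 a pi f x + Gamma2_z_pi a z pi f x + Gamma_I a z pi gam f x) * p x)
  = integral_Rd (fun x =>
    (Hess_beta_sqnorm a z gam lam om al beta f x
     + frakR a z pi gam lam om al beta x (grad f x)) * p x).
Proof.
have [z_smooth _ _] := az_structure.
(* p = pi e^f transfers the smoothness of p and f to pi. *)
have lnpE x : ln (p x) = ln (pi x) + f x.
  by rewrite fE ln_div ?posrE// addrC subrK.
have lnpi_smooth : smooth (fun x => ln (pi x)).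
  have -> : (fun x => ln (pi x)) = fun x => ln (p x) - f x.
    by apply/funext => x; rewrite lnpE addrK.
  by apply: smoothB => //; exact: smooth_ln.
have pi_smooth : smooth pi.
  have [[cpi dpi _] _ _] := pi_invariant.
  apply: (smooth_log_derivative cpi dpi lnpi_smooth) => r x.
  by rewrite partial_ln// mulrCA divff ?gt_eqF// mulr1.
have gam_smooth : smooth_mx gam by rewrite gamE; exact: smooth_gamma_field.
have gam_free x : divg gam x + dot (gam x) (gradlog pi x) = 0.
  by rewrite gamE; exact: (gamma_field_stationary a_smooth b_smooth pi_smooth).
have p_log W x :
    dir W p x = p x * (dot (W x) (gradlog pi x) + dot (W x) (grad f x)).
  rewrite (dir_density p_gt0)// /gradlog -!dirE; congr (_ * _).
  by under eq_fun do rewrite lnpE; rewrite dirD.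
have [na nz na' nz'] := no_boundary.
have GI x : Gamma_I a z pi gam f x =
    (gen a pi f x * dot (grad f x) (gam x)
       - 2^-1 * dot (grad (Gamma1 a f f) x) (gam x))
    + (gen z pi f x * dot (grad f x) (gam x)
       - 2^-1 * dot (grad (Gamma1 z f f) x) (gam x)).
  rewrite /Gamma_I [dot (grad (fun y => Gamma1 a f f y + Gamma1 z f f y) x) _]dotC.
  have sGa := smooth_Gamma1 a_smooth f_smooth f_smooth.
  have sGz := smooth_Gamma1 z_smooth f_smooth f_smooth.
  have -> : dot (gam x) (grad (fun y => Gamma1 a f f y + Gamma1 z f f y) x)
      = dot (grad (Gamma1 a f f) x) (gam x) + dot (grad (Gamma1 z f f) x) (gam x).
    rewrite -dirE dirD// (dirE gam (Gamma1 a f f)) (dirE gam (Gamma1 z f f)).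
    by rewrite [dot (gam x) (grad (Gamma1 a f f) x)]dotC
      [dot (gam x) (grad (Gamma1 z f f) x)]dotC.
  by ring.
have key x : (Hess_beta_sqnorm a z gam lam om al beta f x
     + frakR a z pi gam lam om al beta x (grad f x)) * p x =
    (Gamma2 a pi f x + Gamma2_z_pi a z pi f x + Gamma_I a z pi gam f x) * p x
    + (1 * ((beta - 1)
        * divg (fun y => (p y * dot (grad f y) (gam y)) *: (gram a y *m grad f y)) x
      + (1 - beta) * divg (fun y => (p y * Gamma1 a f f y) *: gam y) x)
      + 1 * (- 1
        * divg (fun y => (p y * dot (grad f y) (gam y)) *: (gram z y *m grad f y)) x
      + 1 * divg (fun y => (p y * Gamma1 z f f y) *: gam y) x)).
  have G2 := Gamma2_completed_square beta a_smooth z_smooth f_smooth pi_smooth pi_gt0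
    az_structure coefE x.
  have Ia := gen_dot_drift gam a_smooth pi_smooth f_smooth pi_gt0 x.
  have Da := drift_by_parts a_smooth p_smooth f_smooth gam_smooth p_log gam_free x.
  have Dz := drift_by_parts z_smooth p_smooth f_smooth gam_smooth p_log gam_free x.
  rewrite GI /frakR.
  (* Products with p x and beta turn the identity into a linear combination of
     the available ones: the drift along a is split with weights beta and
     1 - beta between its pointwise and its integrated form. *)
  have {}G2 := congr1 (fun t => t * p x) G2.
  have {}Ia := congr1 (fun t => beta * t * p x) Ia.
  have Db := congr1 (fun t => beta * t) Da.
  move: G2 Ia Da Db Dz; rewrite /= -/(R_I_a a pi gam x (grad f x)).
  move: (Hess_beta_sqnorm _ _ _ _ _ _ _ _ _) (Gamma2 _ _ _ _)
    (Gamma2_z_pi _ _ _ _ _) (R_I_a _ _ _ _ _) (R_gamma _ a _ _) (R_gamma _ z _ _)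
    (R_a _ _ _ _) (R_z _ _ _ _ _) (R_pi _ _ _ _ _) (gen a _ _ _) (gen z _ _ _)
    (sqnorm (Lambda1 _ _ _ _ _ _ _ _ _)) (sqnorm (Lambda2 _ _ _ _ _ _ _ _))
    (sqnorm (D_mx _ _ _)) (sqnorm (E_mx _ _ _ _)) (p x).
  sum_atoms; field_atoms.
  move=> *; lra.
rewrite (funext key); symmetry; apply: integral_Rd_null.
  have sGa := smooth_Gamma1 a_smooth f_smooth f_smooth.
  have sGz := smooth_Gamma1 z_smooth f_smooth f_smooth.
  have sL := smooth_gen a_smooth lnpi_smooth f_smooth.
  have sLz := smooth_gen z_smooth lnpi_smooth f_smooth.
  have sLGa := smooth_gen a_smooth lnpi_smooth sGa.
  have sLGz := smooth_gen a_smooth lnpi_smooth sGz.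
  have sGLa := smooth_Gamma1 a_smooth sL f_smooth.
  have sGLz := smooth_Gamma1 z_smooth sL f_smooth.
  have sFa := smooth_Gamma1_nabla a_smooth f_smooth.
  have sFz := smooth_Gamma1_nabla z_smooth f_smooth.
  have spiV := smoothV (fun x => lt0r_neq0 (pi_gt0 x)) pi_smooth.
  apply: smooth_continuous; rewrite /Gamma2 /Gamma2_z_pi /Gamma_I /div_pi.
  by smooth.
exact: (null_integral_lin _ _ (null_integral_lin _ _ na na')
  (null_integral_lin _ _ nz nz')).
Qed.
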